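(* Let $M\cong\prec a_1,\ldots,a_m\succ$ and $N\cong\prec b_1,\ldots,b_n\succ$, $m\ge n$, be lattices over the dyadic local field $F$, relative to good BONGs, with $R_i=\operatorname{ord}a_i$, $S_i=\operatorname{ord}b_i$. Let $X_i,Y_i,V_i,W_i$ be (arbitrary) approximations for $a_{1,i}$, $b_{1,i}$, $[a_1,\ldots,a_i]$ and $[b_1,\ldots,b_i]$, respectively (with $W_n=FN$). Assume that (i) for any $1\le i\le n$ either $R_i\le S_i$, or $1<i<m$ and $R_i+R_{i+1}\le S_{i-1}+S_i$. Then the conditions (ii) $d[a_{1,i}b_{1,i}]\ge A_i$ for any $1\le i\le\min\{m-1,n\}$; (iii) $[b_1,\ldots,b_{i-1}]\to[a_1,\ldots,a_i]$ for any $1<i\le\min\{m-1,n+1\}$ such that $R_{i+1}>S_{i-1}$ and $A_{i-1}+A_i>2e+R_i-S_i$; (iv) $[b_1,\ldots,b_{i-1}]\to[a_1,\ldots,a_{i+1}]$ for any $1<i\le\min\{m-2,n+1\}$ such that $S_i\ge R_{i+2}>S_{i-1}+2e\ge R_{i+1}+2e$ all hold if and only if the following conditions all hold: (ii') $d[X_iY_i]\ge A_i$ for any $1\le i\le\min\{m-1,n\}$; (iii') $W_{i-1}\to V_i$ for any $1<i\le\min\{m-1,n+1\}$ such that $R_{i+1}>S_{i-1}$ and $A_{i-1}+A_i>2e+R_i-S_i$; (iv') $W_{i-1}\to V_{i+1}$ for any $1<i\le\min\{m-2,n+1\}$ such that $S_i\ge R_{i+2}>S_{i-1}+2e\ge R_{i+1}+2e$.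 (For $i=n+1$ the inequality $A_{i-1}+A_i>2e+R_i-S_i$ means $A_n+(S_{n+1}+A_{n+1})>2e+R_{n+1}$, and the condition $S_i\ge R_{i+2}$ is ignored.)
   Context: $F$ is a dyadic local field (a finite extension of $\mathbb Q_2$) with ring of integers $\mathcal O$, maximal ideal $\mathfrak p$, normalized valuation $\operatorname{ord}$, and $e=\operatorname{ord}2$. For $a\in F^\times$ the quadratic defect $\mathfrak d(a)$ is the intersection of all ideals $b\mathcal O$ with $b\in F$ such that $a=c^2+b$ for some $c\in F$; $d(a):=\operatorname{ord}(a^{-1}\mathfrak d(a))\in\{0,1,3,\ldots,2e-1,2e,\infty\}$, depending only on the class of $a$ in $F^\times/(F^\times)^2$. Quadratic spaces are finite dimensional nondegenerate, with form $Q$ and bilinear form $B$, $Q(x)=B(x,x)$. $[a_1,\ldots,a_n]$ denotes the space with an orthogonal basis with $Q$-values $a_1,\ldots,a_n$. A lattice $L$ is a finitely generated $\mathcal O$-submodule of a quadratic space with $FL$ nondegenerate; $\mathfrak nL$ is the ideal generated by $Q(L)$. $W\to V$ means that there is an isometric embedding of $W$ into $V$. BONGs: $x\in L$ is a norm generator of $L$ if $\mathfrak nL=Q(x)\mathcal O$. A sequence $x_1,\ldots,x_n$ is a BONG of $L$ if $x_1$ is a norm generator of $L$ and $x_2,\ldots,x_n$ is a BONG of the orthogonal projection $pr_{x_1^\perp}L$. A BONG determines $L$ uniquely; write $L\cong\prec a_1,\ldots,a_n\succ$ when $Q(x_i)=a_i$. The BONG is good if $\operatorname{ord}a_i\le\operatorname{ord}a_{i+2}$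 for $1\le i\le n-2$; every lattice has a good BONG. For a good BONG put $R_i(L)=\operatorname{ord}a_i=:R_i$ and, for $1\le i\le n-1$, let $\alpha_i(L)$ be the minimum of $$\{\tfrac{R_{i+1}-R_i}2+e\}\cup\{R_{i+1}-R_j+d(-a_ja_{j+1})\mid 1\le j\le i\}\cup\{R_{j+1}-R_i+d(-a_ja_{j+1})\mid i\le j\le n-1\}.$$ These do not depend on the good BONG. Notation: $x_{i,j}=x_ix_{i+1}\cdots x_j$, $x_{i,i-1}=1$; $\alpha_i=\alpha_i(M)$, $\beta_i=\alpha_i(N)$. For $\varepsilon\in F^\times$, $0\le i\le m$, $0\le j\le n$: $d[\varepsilon a_{1,i}b_{1,j}]=\min\{d(\varepsilon a_{1,i}b_{1,j}),\alpha_i,\beta_j\}$ and $d[\varepsilon X_iY_j]=\min\{d(\varepsilon X_iY_j),\alpha_i,\beta_j\}$, where $\alpha_i$ is ignored if $i\in\{0,m\}$ and $\beta_j$ is ignored if $j\in\{0,n\}$. For $1\le i\le\min\{m-1,n\}$: $$A_i=\min\{\tfrac{R_{i+1}-S_i}2+e,\;R_{i+1}-S_i+d[-a_{1,i+1}b_{1,i-1}],\;R_{i+1}+R_{i+2}-S_{i-1}-S_i+d[a_{1,i+2}b_{1,i-2}]\},$$ the last term being ignored if $i=1$ or $i=m-1$. If $n\le m-2$, one defines (as a single symbol) $$S_{n+1}+A_{n+1}:=\min\{R_{n+2}+d[-a_{1,n+2}b_{1,n}],\;R_{n+2}+R_{n+3}-S_n+d[a_{1,n+3}b_{1,n-1}]\},$$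 the last term being ignored if $n=m-2$. Approximations. Let $L\cong\prec a_1,\ldots,a_n\succ$ relative to a good BONG, $\alpha_i=\alpha_i(L)$. For $1\le i\le n-1$, $X_i\in F^\times/(F^\times)^2$ is an approximation for $a_{1,i}$ if $d(a_{1,i}X_i)\ge\alpha_i$; for $i\in\{0,n\}$ it is an approximation if $X_i=a_{1,i}$ in $F^\times/(F^\times)^2$. For $1\le i\le n-1$, an $i$-dimensional quadratic space $V_i$ is an approximation for $[a_1,\ldots,a_i]$ if $\det V_i$ is an approximation for $a_{1,i}$ and both: if $\alpha_{i-1}+\alpha_i>2e$ or $i=1$ then $[a_1,\ldots,a_{i-1}]\to V_i$; if $\alpha_i+\alpha_{i+1}>2e$ or $i=n-1$ then $V_i\to[a_1,\ldots,a_{i+1}]$. *)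

(* Defs.v *)
From HB Require Import structures.
From mathcomp Require Import all_boot all_order all_algebra all_field.
From mathcomp Require Import sesquilinear.
From mathcomp Require Import boolp classical_sets constructive_ereal.

Set Implicit Arguments.
Unset Strict Implicit.
Unset Printing Implicit Defensive.

Import Order.TTheory GRing.Theory Num.Theory.

Local Open Scope classical_set_scope.
Local Open Scope ring_scope.

(* A valuation is given by its values v x at the x != 0; its value at 0 is
   never used, and val_geq implements the convention ord 0 = +oo.
   Quantities with values in (1/2)Z or infinite live in \bar rat. *)

Section Valuation.
Variables (K : fieldType) (v : K -> int).

Definition val_geq (x : K) (k : int) : Prop := x = 0 \/ k <= v x.

Record is_valuation : Prop := {
  valuationM : forall x y, x != 0 -> y != 0 -> v (x * y) = v x + v y;
  valuationD : forall x y k, val_geq x k -> val_geq y k -> val_geq (x + y) k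
}.

Definition cauchy_seq (u : nat -> K) : Prop :=
  forall k, exists N, forall i j, (N <= i)%N -> (N <= j)%N ->
    val_geq (u i - u j) k.

Definition converges_to (u : nat -> K) (l : K) : Prop :=
  forall k, exists N, forall i, (N <= i)%N -> val_geq (u i - l) k.

(* (K, v) is the completion of the rationals at the 2-adic valuation. *)
Record is_Q2 : Prop := {
  Q2_char : [pchar K] =i pred0;
  Q2_valuation : is_valuation;
  Q2_rat : forall q : rat, q != 0 ->
    v (ratr q) = (logn 2 `|numq q|%N)%:Z - (logn 2 `|denq q|%N)%:Z;
  Q2_dense : forall x k, exists q : rat, val_geq (x - ratr q) k;
  Q2_complete : forall u, cauchy_seq u -> exists l, converges_to u l
}.

Definition ring_of_integers : set K := [set x | val_geq x 0].

Definition principal (b : K) : set K := [set b * y | y in ring_of_integers].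

Definition is_Osubmodule (I : set K) : Prop :=
  [/\ I 0, forall x y, I x -> I y -> I (x + y) &
      forall c x, ring_of_integers c -> I x -> I (c * x)].

Definition ordE (x : K) : \bar rat := if x == 0 then +oo%E else ((v x)%:Q)%:E.

(* Every fractional ideal is principal; the order of bO is that of b. *)
Definition ideal_ord (I : set K) : \bar rat :=
  ordE (xget 0 [set b | I = principal b]).

Definition quadratic_defect (a : K) : set K :=
  \bigcap_(b in [set b | exists c, a = c ^+ 2 + b]) principal b.

Definition dfct (a : K) : \bar rat :=
  ideal_ord [set a^-1 * x | x in quadratic_defect a].

(* x and y have the same class in K^* / (K^* )^2 *)
Definition same_class (x y : K) : Prop := exists2 c, c != 0 & x = y * c ^+ 2.

End Valuation.

(* The normalized valuation of a finite extension F of (K, v) = Q_2. *)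
Record is_normalized_ord (K : fieldType) (v : K -> int) (F : fieldExtType K)
    (ord : F -> int) : Prop := {
  ord_valuation : is_valuation ord;
  ord_normalized : exists2 x, x != 0 & ord x = 1;
  ord2_gt0 : 0 < ord 2;
  ord_extends : forall c : K, c != 0 -> ord (c%:A) = ord 2 * v c
}.

(* Finite dimensional spaces with a symmetric bilinear form; nondegeneracy is
   the separate predicate nondeg. *)
Record formSpace (F : fieldType) := FormSpace {
  fs_space :> vectType F;
  fs_form : {symmetric fs_space}
}.

Section Spaces.
Variable F : fieldType.
Implicit Types V W : formSpace F.

Definition bil V (x y : V) : F := fs_form V x y.

Definition quad V (x : V) : F := bil x x.

Definition nondeg V : bool := nondegenerate (fs_form V).

Definition embeds W V : Prop :=
  exists2 f : {linear W -> V}, injective f & isometry (fs_form V) (fs_form W) f.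

(* W is isometric to the subset S (a subspace) of V *)
Definition isometric_to_subspace W V (S : set V) : Prop :=
  exists f : {linear W -> V},
    [/\ injective f, isometry (fs_form V) (fs_form W) f & range f = S].

Definition gram_det V : F :=
  \det (\matrix_(i < \dim {:V}, j < \dim {:V})
          bil (vbasis {:V})`_i (vbasis {:V})`_j).

Section Diag.
Variables (a : nat -> F) (n : nat).

Definition diag_form (x y : 'rV[F]_n) : F :=
  \sum_(j < n) a j.+1 * x 0 j * y 0 j.

Lemma diag_form_bilinear : bilinear_for
  (GRing.Scale.Law.clone _ _ ( *%R ) _)
  (GRing.Scale.Law.clone _ _ (idfun \; *%R ) _) diag_form.
Proof.
split=> [y|x] c u w /=; rewrite /diag_form mulr_sumr -big_split /=;
  apply: eq_bigr => j _; rewrite !mxE.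
- by rewrite mulrDr mulrDl mulrCA !mulrA.
- by rewrite mulrDr mulrCA.
Qed.

HB.instance Definition _ := bilinear_isBilinear.Build F
  'rV[F]_n 'rV[F]_n F
  (GRing.Scale.Law.clone _ _ ( *%R ) _)
  (GRing.Scale.Law.clone _ _ (idfun \; *%R ) _)
  diag_form diag_form_bilinear.

Lemma diag_form_sym (x y : 'rV[F]_n) :
  diag_form x y = (-1) ^+ false * idfun (diag_form y x).
Proof. by rewrite mul1r; apply: eq_bigr => j _ /=; rewrite mulrAC. Qed.

HB.instance Definition _ := isHermitianSesquilinear.Build F
  'rV[F]_n false idfun diag_form diag_form_sym.

(* [a_1, ..., a_n] *)
Definition diag_space : formSpace F :=
  @FormSpace F 'rV[F]_n diag_form.

End Diag.
End Spaces.

Section Lattices.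
Variables (F : fieldType) (ord : F -> int) (V : formSpace F).
Implicit Types (L : set V) (x y : V).

Local Notation O := (ring_of_integers ord).

Definition fspan L : set V := [set y | exists c x, L x /\ y = c *: x].

Definition is_lattice L : Prop :=
  (exists s : seq V, L = [set \sum_(i < size s) c i *: s`_i |
     c in [set c : 'I_(size s) -> F | forall i, O (c i)]]) /\
  (forall x, fspan L x -> (forall y, fspan L y -> bil x y = 0) -> x = 0).

Definition norm_ideal L : set F :=
  smallest (is_Osubmodule ord) (@quad F V @` L).

Definition norm_generator L x : Prop :=
  L x /\ norm_ideal L = principal ord (quad x).

Definition proj_perp x y : V := y - (bil x y / quad x) *: x.

(* The condition quad x != 0 is automatic when FL is nondegenerate and
   nonzero; it excludes x = 0 for the zero lattice. *)
Fixpoint bong L (xs : seq V) : Prop :=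
  if xs is x :: xs' then
    [/\ norm_generator L x, quad x != 0 & bong (proj_perp x @` L) xs']
  else L = [set 0].

(* L = < a_1, ..., a_n > relative to a good BONG. Sequences are indexed from
   1, and the values of a outside 1, ..., n are irrelevant. *)
Definition good_bong L (n : nat) (a : nat -> F) : Prop :=
  exists xs : seq V,
    [/\ size xs = n, bong L xs,
        forall i, (1 <= i <= n)%N -> a i = quad xs`_i.-1 &
        forall i, (1 <= i)%N -> (i.+2 <= n)%N -> ord (a i) <= ord (a i.+2)].

End Lattices.

Section Invariants.
Variables (F : fieldType) (ord : F -> int).
Implicit Types (a b X Y : nat -> F) (m n i j : nat).

Local Notation d := (dfct ord).

Definition ram : rat := (ord 2)%:Q.

Definition Rinv a i : rat := (ord (a i))%:Q.

(* a_{1,i} *)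
Definition prefix_prod a i : F := \prod_(1 <= k < i.+1) a k.

Definition alpha n a i : \bar rat :=
  Order.min (((Rinv a i.+1 - Rinv a i) / 2 + ram)%:E)
   (Order.min
     (\big[Order.min/+oo%E]_(1 <= j < i.+1)
        ((Rinv a i.+1 - Rinv a j)%:E + d (- a j * a j.+1))%E)
     (\big[Order.min/+oo%E]_(i <= j < n)
        ((Rinv a j.+1 - Rinv a i)%:E + d (- a j * a j.+1))%E)).

(* alpha_i, ignored (that is, +oo) if i is 0 or n *)
Definition alpha_ign n a i : \bar rat :=
  if (0 < i < n)%N then alpha n a i else +oo%E.

(* d[eps X_i Y_j]; it is d[eps a_{1,i} b_{1,j}] when X = prefix_prod a and
   Y = prefix_prod b *)
Definition dbr m a n b (eps : F) X Y i j : \bar rat :=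
  Order.min (d (eps * X i * Y j))
    (Order.min (alpha_ign m a i) (alpha_ign n b j)).

Definition dab m a n b (eps : F) i j : \bar rat :=
  dbr m a n b eps (prefix_prod a) (prefix_prod b) i j.

Definition Ainv m a n b i : \bar rat :=
  Order.min (((Rinv a i.+1 - Rinv b i) / 2 + ram)%:E)
   (Order.min
     ((Rinv a i.+1 - Rinv b i)%:E + dab m a n b (-1) i.+1 i.-1)%E
     (if (i == 1%N) || (i == m.-1) then +oo%E else
       ((Rinv a i.+1 + Rinv a i.+2 - Rinv b i.-1 - Rinv b i)%:E
        + dab m a n b 1 i.+2 (i - 2)%N)%E)).

(* The single symbol S_{n+1} + A_{n+1}, for n <= m - 2. *)
Definition SAinv m a n b : \bar rat :=
  Order.min
    ((Rinv a n.+2)%:E + dab m a n b (-1) n.+2 n)%E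
    (if n.+2 == m then +oo%E else
      ((Rinv a n.+2 + Rinv a n.+3 - Rinv b n)%:E
       + dab m a n b 1 n.+3 n.-1)%E).

(* A_{i-1} + A_i > 2e + R_i - S_i, read through S_{n+1} + A_{n+1} when
   i = n + 1 *)
Definition Asum_gt m a n b i : Prop :=
  if (i <= n)%N then
    ((2 * ram + Rinv a i - Rinv b i)%:E
       < Ainv m a n b i.-1 + Ainv m a n b i)%E
  else ((2 * ram + Rinv a i)%:E < Ainv m a n b n + SAinv m a n b)%E.

Definition approximates n a i (x : F) : Prop :=
  x != 0 /\
  (if (0 < i < n)%N then is_true (alpha n a i <= d (prefix_prod a i * x)%R)%E
   else same_class x (prefix_prod a i)).

Definition space_approximates n a i (V : formSpace F) : Prop :=
  [/\ nondeg V, \dim {:V} = i, approximates n a i (gram_det V),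
      (i = 1%N \/ ((2 * ram)%:E < alpha n a i.-1 + alpha n a i)%E ->
        embeds (diag_space a i.-1) V) &
      (i = n.-1 \/ ((2 * ram)%:E < alpha n a i + alpha n a i.+1)%E ->
        embeds V (diag_space a i.+1))].

Section Conditions.
Variables (m : nat) (a : nat -> F) (n : nat) (b : nat -> F).

Definition cond_ord : Prop :=
  forall i, (1 <= i <= n)%N ->
    Rinv a i <= Rinv b i \/
    ((1 < i < m)%N /\ Rinv a i + Rinv a i.+1 <= Rinv b i.-1 + Rinv b i).

(* d[a_{1,i} b_{1,i}] >= A_i when X = prefix_prod a and Y = prefix_prod b *)
Definition cond_dbr X Y : Prop :=
  forall i, (1 <= i <= minn m.-1 n)%N ->
    (Ainv m a n b i <= dbr m a n b 1 X Y i i)%E.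

(* [b_1, ..., b_{i-1}] -> [a_1, ..., a_i] when V = diag_space a and
   W = diag_space b; likewise in cond_embed2 *)
Definition cond_embed1 (V W : nat -> formSpace F) : Prop :=
  forall i, (1 < i <= minn m.-1 n.+1)%N ->
    Rinv b i.-1 < Rinv a i.+1 -> Asum_gt m a n b i -> embeds (W i.-1) (V i).

Definition cond_embed2 (V W : nat -> formSpace F) : Prop :=
  forall i, (1 < i <= minn (m - 2) n.+1)%N ->
    ((i <= n)%N -> Rinv a i.+2 <= Rinv b i) ->
    Rinv b i.-1 + 2 * ram < Rinv a i.+2 ->
    Rinv a i.+1 + 2 * ram <= Rinv b i.-1 + 2 * ram ->
    embeds (W i.-1) (V i.+1).

End Conditions.
End Invariants.

(* Main.v *)
(* Two approximations of the same space can be exchanged because the spaces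
   involved form a four-cycle under inclusion in codimension one: if three of
   the four embeddings hold, so does the fourth, provided that a Hilbert symbol
   (x, y) of two products of determinants is 1. The latter follows from
   d(x) + d(y) > 2e.

   With x = d[a_{1,i-1} b_{1,i-1}] and y = d[-a_{1,i+1} b_{1,i-1}], condition
   (ii) and A_{i-1} + A_i > 2e + R_i - S_i give x + y > 2e + R_i - R_{i+1}, and
   then alpha_i + x > 2e or alpha_i + y > 2e. In the first case V_i contains
   [a_1, ..., a_{i-1}], in the second it is contained in [a_1, ..., a_{i+1}],
   and the Hilbert symbol needed is 1; so [a_1, ..., a_i] may be replaced by
   V_i. The replacement of [b_1, ..., b_{i-1}] by W_{i-1} is similar, using
   d[-a_{1,i} b_{1,i-2}] and d[a_{1,i} b_{1,i}].

   In (iv) the orders jump by more than 2e, hence alpha_{i+1} > 2e and V_{i+1}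
   is isometric to [a_1, ..., a_{i+1}], and likewise for W_{i-1}. *)

From HB Require Import structures.
Require Import Defs.
From mathcomp Require Import all_boot all_order all_algebra all_field.
From mathcomp Require Import sesquilinear.
From mathcomp Require Import boolp classical_sets constructive_ereal.
From mathcomp Require Import ring lra zify.

Set Implicit Arguments.
Unset Strict Implicit.
Unset Printing Implicit Defensive.

Import Order.TTheory GRing.Theory Num.Theory.

Local Open Scope ring_scope.

(** * Representations of symmetric matrices *)

(** The alternative for alpha_i comes from the domination principle d(u v) >= min(d(u), d(v)): up to
    squares, -a_i a_{i+1} is the product of a_{1,i-1} b_{1,i-1} and -a_{1,i+1} b_{1,i-1}, so d(-a_i
    a_{i+1}), capped by the neighbouring alphas, is at least min(x, y); this capped defect is what
    bounds alpha_i from below. The caps built into the brackets d[...] also allow the two exchanges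
    to be made one after the other: det V_i differs from a_{1,i} by a factor of defect at least
    alpha_i, so once V_i is in place the bounds for the exchange of [b_1, ..., b_{i-1}] survive. For
    the same reason (ii) and (ii') are equivalent on their own, whereas (iii) and (iii') are
    compared in the presence of (ii). Hilbert symbols appear only as explicit norm equations b = s^2
    - a t^2, which rescale binary spaces; that d(a) + d(b) > 2e makes such an equation solvable
    rests on the local square theorem, hence on the completeness of F. *)

Section MatrixRepresentation.
Variable F : fieldType.

(** The rows of [P] are the images of a basis with Gram matrix [B]. For invertible [B] such a map is
    automatically injective, so this is embedding in coordinates. *)
Definition mx_repr k n (A : 'M[F]_n) (B : 'M[F]_k) : Prop :=
  exists P : 'M[F]_(k, n), P *m A *m P^T = B.

Definition ext k (c : F) (A : 'M[F]_k) : 'M[F]_k.+1 :=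
  block_mx (c%:M : 'M_1) 0 0 A : 'M_(1 + k).

Lemma mx_repr_refl n (A : 'M[F]_n) : mx_repr A A.
Proof. by exists 1%:M; rewrite mul1mx trmx1 mulmx1. Qed.

Lemma mx_repr_trans n k l (A : 'M[F]_n) (B : 'M[F]_k) (C : 'M[F]_l) :
  mx_repr A B -> mx_repr B C -> mx_repr A C.
Proof.
by move=> [P <-] [Q <-]; exists (Q *m P); rewrite trmx_mul !mulmxA.
Qed.

Lemma mx_repr_sym n (A B : 'M[F]_n) :
  B \in unitmx -> mx_repr A B -> mx_repr B A.
Proof.
move=> Bu [P defB].
have Pu : P \in unitmx by move: Bu; rewrite -defB !unitmx_mul => /andP[/andP[]].
exists (invmx P); rewrite -defB -!mulmxA -trmx_mul mulVmx // trmx1 mulmx1.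
by rewrite mulmxA mulVmx // mul1mx.
Qed.

Lemma mx_repr_det n (A B : 'M[F]_n) :
  B \in unitmx -> mx_repr A B ->
  exists2 s, s != 0 & \det B = \det A * s ^+ 2.
Proof.
move=> Bu [P defB]; exists (\det P).
  by move: Bu; rewrite -defB !unitmx_mul => /andP[/andP[]]; rewrite unitmxE unitfE.
by rewrite -defB !det_mulmx det_tr mulrC mulrA mulrC expr2.
Qed.

Lemma det_ext k c (A : 'M[F]_k) : \det (ext c A) = c * \det A.
Proof. by rewrite [LHS](@det_ublock _ 1) det_scalar1. Qed.

Lemma ext_unit k c (A : 'M[F]_k) :
  (ext c A \in unitmx) = (c != 0) && (A \in unitmx).
Proof. by rewrite !unitmxE !unitfE det_ext mulf_eq0 negb_or. Qed.

Lemma ext_sym k c (A : 'M[F]_k) : A^T = A -> (ext c A)^T = ext c A.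
Proof.
by move=> sA; rewrite /ext (tr_block_mx (c%:M : 'M_1)) !trmx0 tr_scalar_mx sA.
Qed.

Lemma mx_repr_ext k l c (A : 'M[F]_k) (B : 'M[F]_l) :
  mx_repr A B -> mx_repr (ext c A) (ext c B).
Proof.
move=> [P defB]; exists (block_mx 1 0 0 P : 'M_(1 + l, 1 + k)).
rewrite (tr_block_mx (1 : 'M_1)) /ext.
rewrite !(mulmx_block (m1 := 1) (n1 := 1) (p1 := 1)).
by rewrite !(mul0mx, mulmx0, trmx0, trmx1, mulmx1, mul1mx, add0r, addr0) defB.
Qed.

Lemma mx_repr_ext_scale k c s (A : 'M[F]_k) :
  mx_repr (ext c A) (ext (c * s ^+ 2) A).
Proof.
exists (block_mx s%:M 0 0 1%:M : 'M_(1 + k, 1 + k)).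
rewrite (tr_block_mx (s%:M : 'M_1)) /ext.
rewrite !(mulmx_block (m1 := 1) (n1 := 1) (p1 := 1)).
rewrite !(mul0mx, mulmx0, trmx0, trmx1, mulmx1, mul1mx, add0r, addr0).
by rewrite tr_scalar_mx -!scalar_mxM mulrAC [s * s]mulrC mulrC expr2.
Qed.

Lemma mx_repr_ext_drop k c (A : 'M[F]_k) : mx_repr (ext c A) A.
Proof.
exists (row_mx 0 1%:M : 'M_(k, 1 + k)).
rewrite (tr_row_mx (0 : 'M_(_, 1))) /ext.
rewrite (mul_row_block (n1 := 1) (p1 := 1)) (mul_row_col (n1 := 1)).
by rewrite !(mul0mx, mulmx0, trmx0, trmx1, mulmx1, mul1mx, add0r, addr0).
Qed.

(** Change of basis in the plane [[u, c]]: the rows [(p, q)] and [(r, s)] are the new vectors, and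
    the three equations give their Gram matrix. *)
Lemma mx_repr_binary k (u c u' c' p q r s : F) (A : 'M[F]_k) :
  p ^+ 2 * u + q ^+ 2 * c = u' -> r ^+ 2 * u + s ^+ 2 * c = c' ->
  p * u * r + q * c * s = 0 ->
  mx_repr (ext u (ext c A)) (ext u' (ext c' A)).
Proof.
move=> e1 e2 e3.
pose P2 := block_mx (s%:M : 'M_1) 0 0 (1%:M : 'M_k).
pose v x : 'rV[F]_(1 + k) := row_mx x%:M 0.
exists (block_mx (p%:M : 'M_1) (v q) (v r)^T P2 : 'M_(1 + (1 + k))).
rewrite (tr_block_mx (p%:M : 'M_1)) {1 3}/ext trmxK.
rewrite (mulmx_block (m1 := 1) (n1 := 1) (p1 := 1)).
rewrite (mulmx_block (m1 := 1) (n1 := 1) (p1 := 1)).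
rewrite !(mul0mx, mulmx0, add0r, addr0).
have vE x : v x *m ext c A = v (x * c).
  rewrite /v /ext (mul_row_block (n1 := 1) (p1 := 1)) !mulmx0 !mul0mx !addr0.
  by rewrite scalar_mxM.
have vv x y : v x *m (v y)^T = (x * y)%:M.
  by rewrite /v tr_row_mx mul_row_col trmx0 mulmx0 addr0 tr_scalar_mx -scalar_mxM.
have vP x : v x *m P2^T = v (x * s).
  rewrite /v /P2 tr_block_mx (mul_row_block (n1 := 1) (p1 := 1)).
  by rewrite !(mulmx0, mul0mx, trmx0, addr0) tr_scalar_mx -scalar_mxM.
have Pv x : P2 *m (v x)^T = (v (x * s))^T.
  by rewrite -[P2]trmxK -trmx_mul vP.
have Ev x : ext c A *m (v x)^T = (v (x * c))^T.
  rewrite /v !tr_row_mx /ext (mul_block_col (m1 := 1) (n1 := 1)) !trmx0 !mulmx0 mul0mx.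
  by rewrite !addr0 !tr_scalar_mx mulrC scalar_mxM.
have vZ x y : (v x)^T *m (y%:M : 'M_1) = (v (x * y))^T.
  by rewrite mul_mx_scalar -linearZ /v /= scale_row_mx scaler0 scale_scalar_mx mulrC.
have Zv x y : (y%:M : 'M_1) *m v x = v (x * y).
  by rewrite mul_scalar_mx scale_row_mx scaler0 scale_scalar_mx mulrC.
have vD x y : v x + v y = v (x + y).
  by rewrite /v add_row_mx addr0 -raddfD.
have v0 : v 0 = 0 by rewrite /v raddf0 row_mx0.
have vTv x y : (v x)^T *m v y = block_mx ((x * y)%:M : 'M_1) 0 0 0.
  rewrite /v tr_row_mx mul_col_row !(mulmx0, mul0mx, trmx0).
  by rewrite tr_scalar_mx -scalar_mxM.
have PP : P2 *m ext c A *m P2^T = block_mx ((s ^+ 2 * c)%:M : 'M_1) 0 0 A.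
  rewrite /P2 /ext (tr_block_mx (s%:M : 'M_1)).
  rewrite !(mulmx_block (m1 := 1) (n1 := 1) (p1 := 1)).
  rewrite !(mul0mx, mulmx0, trmx0, trmx1, mulmx1, mul1mx, add0r, addr0).
  by rewrite tr_scalar_mx -!scalar_mxM; congr (block_mx _%:M); ring.
congr (@block_mx _ 1 (1 + k) 1 (1 + k) _ _ _ _).
- by rewrite vE vv tr_scalar_mx -!scalar_mxM -raddfD /= -e1; congr _%:M; ring.
- by rewrite -scalar_mxM Zv vE vP vD -v0 -e3; congr v; ring.
- rewrite vZ tr_scalar_mx vZ -mulmxA Ev Pv -linearD /= vD -[RHS]trmx0 -v0 -e3.
  by congr (v _)^T; ring.
- rewrite vZ vTv PP (add_block_mx (m1 := 1) (n1 := 1)) !add0r -raddfD /= -e2.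
  by congr (block_mx _%:M); ring.
Qed.

Lemma mx_repr_swap k u c (A : 'M[F]_k) :
  mx_repr (ext u (ext c A)) (ext c (ext u A)).
Proof. by apply: (@mx_repr_binary _ _ _ _ _ 0 1 1 0); ring. Qed.

(** The orthogonal complement of a nondegenerate hyperplane is a line; its generator [x] is in the
    left kernel of [A *m P^T], which has more rows than columns. *)
Lemma mx_repr_split k (A : 'M[F]_k.+1) (B : 'M[F]_k) :
  A^T = A -> A \in unitmx -> B \in unitmx -> mx_repr A B ->
  exists2 c, c != 0 & mx_repr A (ext c B).
Proof.
move=> sA Au Bu [P defB].
have /rowV0Pn[x /sub_kermxP xAP xn0] : kermx (A *m P^T) != 0.
  rewrite kermx_eq0 /row_free; apply: contraTneq (rank_leq_col (A *m P^T)) => ->.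
  by rewrite ltnn.
rewrite mulmxA in xAP.
have PAx : P *m A *m x^T = 0.
  by rewrite -[P]trmxK -[A]sA -!trmx_mul mulmxA xAP trmx0.
pose Q : 'M_(1 + k) := col_mx x P.
pose c := (x *m A *m x^T) 0 0.
have QAQ : Q *m A *m Q^T = ext c B.
  rewrite /Q tr_col_mx mul_col_mx mul_col_row xAP PAx defB.
  by rewrite [x *m A *m x^T]mx11_scalar.
have Qu : Q \in unitmx.
  rewrite -row_free_unit -kermx_eq0; apply/rowV0P => y /sub_kermxP.
  rewrite -[y](hsubmxK (n1 := 1)) /Q (mul_row_col (n1 := 1)).
  set y1 := lsubmx _; set y2 := rsubmx _ => e.
  have y20 : y2 = 0.
    have := congr1 (fun z => z *m A *m P^T) e.
    rewrite !mulmxDl -!mulmxA [P *m _]mulmxA defB [x *m _]mulmxA xAP mulmx0 add0r.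
    by rewrite !mul0mx => /(congr1 (mulmx^~ (invmx B))); rewrite mulmxK // mul0mx.
  move: e; rewrite y20 mul0mx addr0 [y1]mx11_scalar mul_scalar_mx => /eqP.
  by rewrite scaler_eq0 (negPf xn0) orbF => /eqP ->; rewrite raddf0 row_mx0.
exists c; last by exists Q.
have: ext c B \in unitmx by rewrite -QAQ !unitmx_mul Qu Au unitmx_tr Qu.
by rewrite ext_unit => /andP[].
Qed.

(** On row vectors, acting from the right, [S] is the reflection taking [y] to [y] minus
    [2 B(y, x) / Q(x)] times [x]. *)
Lemma reflection_isometry n (G : 'M[F]_n) (x : 'rV[F]_n) :
  G^T = G -> (x *m G *m x^T) 0 0 != 0 ->
  let S := 1%:M - (2 / (x *m G *m x^T) 0 0) *: (G *m x^T *m x) in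
  S *m G *m S^T = G.
Proof.
move=> sG qn0 /=; set q := (x *m G *m x^T) 0 0 in qn0 *.
have qE : x *m (G *m x^T) = q%:M by rewrite mulmxA [LHS]mx11_scalar.
set t := 2 / q; have tq : t * q = 2 by rewrite divfK.
pose Y := G *m x^T *m x *m G.
have YE : Y *m (G *m x^T *m x)^T = q *: Y.
  have -> : (G *m x^T *m x)^T = x^T *m (x *m G) by rewrite !trmx_mul trmxK sG.
  have -> : Y = G *m x^T *m (x *m G) by rewrite /Y !mulmxA.
  rewrite mulmxA -[_ *m (x *m G) *m x^T]mulmxA [x *m G *m x^T]mx11_scalar -/q.
  by rewrite mul_mx_scalar -scalemxAl.
have GN : G *m (G *m x^T *m x)^T = Y.
  by rewrite /Y !trmx_mul trmxK sG !mulmxA.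
rewrite [(_ - _)^T]linearB /= trmx1 [(_ *: _)^T]linearZ /= mulmxBr mulmx1.
rewrite mulmxBl mul1mx.
rewrite -scalemxAr mulmxBl GN -!scalemxAl -/Y YE scalerBr.
have -> : t *: (t *: (q *: Y)) = 2 *: (t *: Y).
  by rewrite !scalerA; congr (_ *: _); rewrite -mulrA tq mulrC.
by rewrite scaler_nat mulr2n opprB addrK subrK.
Qed.

(* Witt cancellation of a line: a reflection, up to sign, carries any vector
   of norm [c] to the basis vector of the summand [c]. *)
Lemma mx_repr_cancel k c (A B : 'M[F]_k) :
  (2 : F) != 0 -> c != 0 -> A^T = A ->
  mx_repr (ext c A) (ext c B) -> mx_repr A B.
Proof.
move=> two cn0 sA [P defP]; set G := ext c A in defP.
have sG : G^T = G := ext_sym c sA.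
pose v : 'rV[F]_(1 + k) := row_mx 1 0; pose e := usubmx (P : 'M_(1 + k, _)).
have vG : v *m G = row_mx c%:M 0.
  rewrite /v /G /ext (mul_row_block (n1 := 1) (p1 := 1)) !mul0mx mul1mx mulmx0.
  by rewrite !addr0.
have vGv : v *m G *m v^T = c%:M.
  by rewrite vG /v tr_row_mx (mul_row_col (n1 := 1)) mul0mx addr0 trmx1 mulmx1.
have eGe : e *m G *m e^T = c%:M.
  rewrite /e mul_usub_mx trmx_usub mulmx_lsub mul_usub_mx defP.
  exact: block_mxKul.
pose w := e *m G *m v^T.
have wE : v *m G *m e^T = w.
  have -> : v *m G *m e^T = w^T by rewrite /w !trmx_mul trmxK sG mulmxA.
  by rewrite [w]mx11_scalar tr_scalar_mx.
(* The first row of [P *m S] is then [v], and orthogonality of the other rows to it makes the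
   remaining block represent [B] in [A]. *)
suff [S SG eS] : exists2 S, S *m G *m S^T = G & e *m S = v.
  have : P *m S *m G *m (P *m S)^T = ext c B.
    by rewrite trmx_mul mulmxA -[P *m S *m G]mulmxA -[P *m _ *m S^T]mulmxA SG.
  have : usubmx (P *m S : 'M_(1 + k, _)) = v by rewrite -mul_usub_mx.
  move: (P *m S : 'M_(1 + k, 1 + k)) => R uR.
  have -> : R = block_mx 1 0 (dlsubmx R) (drsubmx R).
    by rewrite -[LHS]submxK /ulsubmx /ursubmx uR row_mxKl row_mxKr.
  set p := dlsubmx _; set P1 := drsubmx _.
  rewrite /G /ext (tr_block_mx (1 : 'M_1)).
  rewrite !(mulmx_block (m1 := 1) (n1 := 1) (p1 := 1)).
  rewrite !(mul0mx, mulmx0, trmx0, trmx1, mulmx1, mul1mx, add0r, addr0).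
  move=> /(@eq_block_mx _ 1 k 1 k)[_ _ p0 <-]; exists P1.
  by rewrite p0 mul0mx add0r.
(* Since [e] and [v] have the same norm [c], the equation holds for [x = e - v] and [x = e + v]; the
   reflection in such an [x] sends [e] to [e - x]. *)
have dbl (x : 'rV_(1 + k)) : x *m G *m x^T = 2 *: (e *m G *m x^T) ->
    (x *m G *m x^T) 0 0 != 0 -> exists2 S, S *m G *m S^T = G & e *m S = e - x.
  move=> xE qn0; have := reflection_isometry sG qn0 => /=.
  set S := _ - _ => SG; exists S => //.
  rewrite /S mulmxBr mulmx1 -scalemxAr !mulmxA.
  have eGx : e *m G *m x^T = ((x *m G *m x^T) 0 0 / 2)%:M.
    by rewrite xE [fun_of_matrix (2 *: _) 0 0]mxE [2 * _]mulrC mulfK // -mx11_scalar.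
  rewrite eGx mul_scalar_mx scalerA; set q := (_ 0 0) in qn0 *.
  by rewrite [2 / q * _]mulrA divfK // divff // scale1r.
have [z|nz] := eqVneq (((e - v) *m G *m (e - v)^T) 0 0) 0; last first.
  have [||S SG eS] := dbl (e - v) => //.
    rewrite linearB /= !(mulmxBl, mulmxBr) eGe vGv wE -/w scaler_nat mulr2n.
    by rewrite opprB.
  by exists S; rewrite // eS opprB addrC subrK.
have [||S SG eS] := dbl (e + v).
- rewrite linearD /= !(mulmxDl, mulmxDr) eGe vGv wE -/w scaler_nat mulr2n.
  by rewrite [w + _]addrC.
(* The norms of [e - v] and [e + v] add up to [4 c], so they do not both vanish. *)
- apply: contraNneq (mulf_neq0 (mulf_neq0 two two) cn0) => z'.
  have := congr2 +%R z z'.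
  rewrite addr0 !linearD !linearN /= !(mulmxDl, mulmxDr, mulmxN, mulNmx) eGe vGv wE -/w.
  by rewrite !mxE !eqxx !mulr1n => <-; apply/eqP; ring.
exists (- S); first by rewrite linearN /= mulNmx mulmxN mulNmx opprK.
by rewrite mulmxN eS opprB addrC addKr.
Qed.

(** Comparing determinants, the complementary line has norm [\det A / \det B], which is
    [\det A * \det B] up to a square. *)
Lemma mx_repr_split_det k (A : 'M[F]_k.+1) (B : 'M[F]_k) :
  A^T = A -> A \in unitmx -> B \in unitmx -> mx_repr A B ->
  mx_repr A (ext (\det A * \det B) B).
Proof.
move=> sA Au Bu /mx_repr_split[] // c cn0 Ac.
have [|s sn0 e] := mx_repr_det _ Ac; first by rewrite ext_unit cn0.
have Bn0 : \det B != 0 by rewrite -unitfE -unitmxE.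
apply: mx_repr_trans Ac _.
have -> : \det A * \det B = c * (\det B / s) ^+ 2.
  have -> : \det A = c * \det B / s ^+ 2.
    by rewrite -det_ext e mulfK // expf_neq0.
  by field.
exact: mx_repr_ext_scale.
Qed.

(* For nonzero [a], [b] this says that the Hilbert symbol (a, b) is 1. *)
Definition is_norm (a b : F) := exists s t, b = s ^+ 2 - a * t ^+ 2.

(** The norm form factors, and the witnesses solve [s - a t = 1], [s + a t = b]. *)
Lemma is_norm_square (a b : F) : (2 : F) != 0 -> a != 0 -> is_norm (a ^+ 2) b.
Proof.
by move=> two an0; exists ((b + 1) / 2), ((b - 1) / (2 * a)); field; apply/andP.
Qed.

Lemma is_norm_scale (a b r s : F) :
  r != 0 -> is_norm a b -> is_norm (a * r ^+ 2) (b * s ^+ 2).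
Proof. by move=> rn0 [x [y ->]]; exists (x * s), (y * s / r); field. Qed.

(** With [x = s^2 + u c t^2], the vectors [(s, u t)] and [(- c t, s)] of the plane [[u, c]] are
    orthogonal of norms [u x] and [c x]. *)
Lemma mx_repr_binary_scale k (u c x : F) (A : 'M[F]_k) :
  is_norm (- (u * c)) x ->
  mx_repr (ext u (ext c A)) (ext (u * x) (ext (c * x) A)).
Proof.
move=> [s [t ->]].
by apply: (@mx_repr_binary _ _ _ _ _ s (u * t) (- (c * t)) s); ring.
Qed.

Hypothesis two : (2 : F) != 0.

(** * Completing four-cycles of spaces in codimension one *)

Section FourCycles.
Variable k : nat.
Implicit Types (T W : 'M[F]_k) (U V : 'M[F]_k.+1) (D : 'M[F]_k.+2).

Let det_n0 n (A : 'M[F]_n) : A \in unitmx -> \det A != 0.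
Proof. by rewrite unitmxE unitfE. Qed.

(* If [U = T + [u] = W + [c]] and [V = T + [u x]], where [x] is a norm for
   [c u], then [V + [- c x]] is [U + [- c]], that is [W + [c x] + [- c x]]. *)
Lemma mx_repr_square T W U V :
  T \in unitmx -> W \in unitmx -> U \in unitmx -> V \in unitmx ->
  T^T = T -> U^T = U -> V^T = V ->
  mx_repr U T -> mx_repr V T -> mx_repr U W ->
  is_norm (\det T * \det W) (\det U * \det V) -> mx_repr V W.
Proof.
move=> Tu Wu Uu Vu sT sU sV UT VT UW nrm.
have [tn0 wn0] := (det_n0 Tu, det_n0 Wu); have [un0 vn0] := (det_n0 Uu, det_n0 Vu).
have {}UT := mx_repr_split_det sU Uu Tu UT.
have {}VT := mx_repr_split_det sV Vu Tu VT.
have {}UW := mx_repr_split_det sU Uu Wu UW.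
set x := \det U * \det V in nrm; set u := \det U * _ in UT; set c := _ * _ in UW.
have xn0 : x != 0 by rewrite mulf_neq0.
have u0 : u != 0 by rewrite mulf_neq0.
have cn0 : c != 0 by rewrite mulf_neq0.
have VT' : mx_repr V (ext (u * x) T).
  have -> : u * x = \det V * \det T * (\det U) ^+ 2 by rewrite /u /x; ring.
  by apply: mx_repr_trans VT _; apply: mx_repr_ext_scale.
apply: mx_repr_trans VT' (mx_repr_trans _ (mx_repr_ext_drop (c * x) W)).
apply: (@mx_repr_cancel _ (- c * x)) => //; first by rewrite mulf_neq0 ?oppr_eq0.
  exact: ext_sym.
apply: (@mx_repr_trans _ _ _ _ (ext u (ext (- c) T))).
  apply: mx_repr_trans (mx_repr_swap _ _ _) _; apply: mx_repr_sym.
    by rewrite !ext_unit ?mulf_neq0 ?oppr_eq0 //.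
  apply: mx_repr_binary_scale.
  have -> : - (u * - c) = \det T * \det W * (\det U) ^+ 2 by rewrite /u /c; ring.
  by rewrite -[x]mulr1 -(expr1n _ 2); apply: is_norm_scale.
apply: (@mx_repr_trans _ _ _ _ (ext (- c) U)).
  apply: mx_repr_trans (mx_repr_swap _ _ _) _; apply: mx_repr_ext.
  by apply: mx_repr_sym UT; rewrite ext_unit u0.
apply: mx_repr_trans (mx_repr_ext (- c) UW) _.
(* The plane [[- c, c]] is hyperbolic: for the square [c ^+ 2] every [x] is a norm. *)
apply: mx_repr_binary_scale.
by rewrite mulNr opprK -expr2; apply: is_norm_square.
Qed.

(** Write [D = U + [u] = V + [u x]] and [U = W + [c]]. The plane [[u, c]] may be multiplied by [x],
    and cancelling [[u x]] leaves [V = W + [c x]]; up to squares, [- u c] is minus the product of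
    [\det W] and [\det D]. *)
Lemma mx_repr_diamond_bottom W U V D :
  W \in unitmx -> U \in unitmx -> V \in unitmx -> D \in unitmx ->
  U^T = U -> V^T = V -> D^T = D ->
  mx_repr D U -> mx_repr D V -> mx_repr U W ->
  is_norm (- (\det W * \det D)) (\det U * \det V) -> mx_repr V W.
Proof.
move=> Wu Uu Vu Du sU sV sD DU DV UW nrm.
have [dn0 wn0] := (det_n0 Du, det_n0 Wu); have [un0 vn0] := (det_n0 Uu, det_n0 Vu).
have {}DU := mx_repr_split_det sD Du Uu DU.
have {}DV := mx_repr_split_det sD Du Vu DV.
have {}UW := mx_repr_split_det sU Uu Wu UW.
set x := \det U * \det V in nrm; set u := _ * _ in DU; set c := _ * _ in UW.
have DV' : mx_repr D (ext (u * x) V).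
  have -> : u * x = \det D * \det V * (\det U) ^+ 2 by rewrite /u /x; ring.
  by apply: mx_repr_trans DV _; apply: mx_repr_ext_scale.
apply: (mx_repr_trans _ (mx_repr_ext_drop (c * x) W)).
apply: (@mx_repr_cancel _ (u * x)) => //; first by rewrite !mulf_neq0.
apply: (@mx_repr_trans _ _ _ _ D).
  by apply: mx_repr_sym DV'; rewrite ext_unit !mulf_neq0.
apply: mx_repr_trans DU (mx_repr_trans (mx_repr_ext _ UW) _).
apply: mx_repr_binary_scale.
have -> : - (u * c) = - (\det W * \det D) * (\det U) ^+ 2 by rewrite /u /c; ring.
by rewrite -[x]mulr1 -(expr1n _ 2); apply: is_norm_scale.
Qed.

(** Write [U = W + [u]], [V = W + [u x]] and [D = U + [c]]. Multiplying the plane [[c, u]] by [x]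
    turns [D] into [W + [u x] + [c x]], which contains [V]. *)
Lemma mx_repr_diamond_top W U V D :
  W \in unitmx -> U \in unitmx -> V \in unitmx -> D \in unitmx ->
  U^T = U -> V^T = V -> D^T = D ->
  mx_repr U W -> mx_repr V W -> mx_repr D U ->
  is_norm (- (\det W * \det D)) (\det U * \det V) -> mx_repr D V.
Proof.
move=> Wu Uu Vu Du sU sV sD UW VW DU nrm.
have [dn0 wn0] := (det_n0 Du, det_n0 Wu); have [un0 vn0] := (det_n0 Uu, det_n0 Vu).
have {}DU := mx_repr_split_det sD Du Uu DU.
have {}VW := mx_repr_split_det sV Vu Wu VW.
have {}UW := mx_repr_split_det sU Uu Wu UW.
set x := \det U * \det V in nrm; set u := _ * _ in UW; set c := _ * _ in DU.
have VW' : mx_repr V (ext (u * x) W).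
  have -> : u * x = \det V * \det W * (\det U) ^+ 2 by rewrite /u /x; ring.
  by apply: mx_repr_trans VW _; apply: mx_repr_ext_scale.
have {}VW' : mx_repr (ext (u * x) W) V.
  by apply: mx_repr_sym VW'; rewrite ext_unit !mulf_neq0.
apply: mx_repr_trans DU (mx_repr_trans (mx_repr_ext _ UW) _).
apply: (mx_repr_trans _ VW'); apply: (mx_repr_trans _ (mx_repr_ext_drop (c * x) _)).
apply: mx_repr_binary_scale.
have -> : - (c * u) = - (\det W * \det D) * (\det U) ^+ 2 by rewrite /u /c; ring.
by rewrite -[x]mulr1 -(expr1n _ 2); apply: is_norm_scale.
Qed.

(** The lines complementary to [T] in [U] and in [V] have norms in the same square class. *)
Lemma mx_repr_same_det T U V s :
  T \in unitmx -> U \in unitmx -> V \in unitmx -> U^T = U -> V^T = V ->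
  mx_repr U T -> mx_repr V T -> \det V = \det U * s ^+ 2 -> mx_repr U V.
Proof.
move=> Tu Uu Vu sU sV UT VT dV; have [tn0 vn0] := (det_n0 Tu, det_n0 Vu).
apply: mx_repr_trans (mx_repr_split_det sU Uu Tu UT) _.
apply: mx_repr_trans (mx_repr_ext_scale _ s _) _.
rewrite mulrAC -dV; apply: mx_repr_sym; last exact: mx_repr_split_det.
by rewrite ext_unit mulf_neq0.
Qed.

End FourCycles.
End MatrixRepresentation.

(** * Valuations and completeness *)

Section Valuations.
Variables (K : fieldType) (v : K -> int).
Hypothesis Vv : is_valuation v.

Lemma valuation1 : v 1 = 0.
Proof.
have := valuationM Vv (oner_neq0 K) (oner_neq0 K); rewrite mulr1.
by move: (v 1) => z; lia.
Qed.

Lemma valuationN x : x != 0 -> v (- x) = v x.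
Proof.
have n1 : (-1 : K) != 0 by rewrite oppr_eq0 oner_neq0.
have v1 : v (-1) = 0.
  by have := valuationM Vv n1 n1; rewrite mulrNN mulr1 valuation1; move: (v _) => z; lia.
by move=> xn0; rewrite -mulN1r (valuationM Vv) // v1 add0r.
Qed.

Lemma valuationV x : x != 0 -> v x^-1 = - v x.
Proof.
move=> xn0; have := valuationM Vv xn0 (invr_neq0 xn0).
by rewrite divff // valuation1; move: (v _) (v _) => y z; lia.
Qed.

Lemma val_geqW x k l : l <= k -> val_geq v x k -> val_geq v x l.
Proof. by move=> lk [->|h]; [left | right; lia]. Qed.

Lemma val_geqN x k : val_geq v x k -> val_geq v (- x) k.
Proof.
have [->|xn0] := eqVneq x 0; first by rewrite oppr0.
by move=> [x0|h]; [rewrite x0 eqxx in xn0 | right; rewrite valuationN].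
Qed.

Lemma val_geqB x y k : val_geq v x k -> val_geq v y k -> val_geq v (x - y) k.
Proof. by move=> hx hy; apply: valuationD => //; apply: val_geqN. Qed.

Lemma val_geqM x y k l :
  val_geq v x k -> val_geq v y l -> val_geq v (x * y) (k + l).
Proof.
have [->|xn0] := eqVneq x 0; first by rewrite mul0r; left.
have [->|yn0] := eqVneq y 0; first by rewrite mulr0; left.
move=> [x0|hx]; first by rewrite x0 eqxx in xn0.
move=> [y0|hy]; first by rewrite y0 eqxx in yn0.
by right; rewrite (valuationM Vv) //; lia.
Qed.

Lemma val_geq_eq0 x : (forall k, val_geq v x k) -> x = 0.
Proof. by move=> h; case: (h (v x + 1)) => // ?; lia. Qed.

Lemma converges_unique u l l' :
  converges_to v u l -> converges_to v u l' -> l = l'.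
Proof.
move=> ul ul'; apply/eqP; rewrite -subr_eq0; apply/eqP/val_geq_eq0 => k.
have [N hN] := ul k; have [N' hN'] := ul' k.
have -> : l - l' = (u (maxn N N') - l') - (u (maxn N N') - l) by ring.
by apply: val_geqB; [apply: hN'; rewrite leq_maxr | apply: hN; rewrite leq_maxl].
Qed.

End Valuations.

(** * Completeness of finite extensions of the 2-adic field *)

Section Completeness.
Variables (K : fieldType) (v : K -> int) (HK : is_Q2 v).
Variables (F : fieldExtType K) (ord : F -> int).
Hypothesis Hord : is_normalized_ord v ord.

Let VF := ord_valuation Hord.

Lemma ordZ c (x : F) : c != 0 -> x != 0 -> ord (c *: x) = ord 2 * v c + ord x.
Proof.
move=> cn0 xn0; rewrite -mulr_algl (valuationM VF) ?(ord_extends Hord) //.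
by rewrite scaler_eq0 negb_or cn0 oner_neq0.
Qed.

Lemma val_geqZ c (x : F) k :
  val_geq v c k -> val_geq ord (c *: x) (ord 2 * k + ord x).
Proof.
have [->|xn0] := eqVneq x 0; first by rewrite scaler0; left.
have [->|cn0] := eqVneq c 0; first by rewrite scale0r; left.
move=> [c0|h]; first by rewrite c0 eqxx in cn0.
by right; rewrite ordZ //; have := ord2_gt0 Hord; nia.
Qed.

(* For [u = u' + c e] with [u'] in a smaller complete subspace: if [c] is not
   Cauchy, dividing by the differences of [c] shows that [e] is a limit of
   points of that subspace. *)
Lemma cauchy_subspace n (U : {vspace F}) (u : nat -> F) :
  \dim U = n -> (forall i, u i \in U) -> cauchy_seq ord u ->
  exists2 l, l \in U & converges_to ord u l.
Proof.
elim: n => [|n IH] in U u *; move=> dU uU cu.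
  exists 0; first exact: mem0v.
  move=> k; exists 0%N => i _; left.
  by move/eqP: dU; rewrite dimv_eq0 => /eqP U0; apply/eqP; rewrite subr0 -memv0 -U0.
pose e := vpick U; pose U' := (U :\: <[e]>)%VS.
have en0 : e != 0 by rewrite vpick0 -dimv_eq0 dU.
have eU : (<[e]> <= U)%VS by rewrite -memvE memv_pick.
have dU' : \dim U' = n.
  have := dimv_cap_compl U <[e]>; rewrite (capv_idPr eU) dim_vline en0 dU.
  by rewrite add1n => -[].
have eU' : e \notin U'.
  apply: contra en0 => eU'; rewrite -memv0 -(capv_diff U <[e]>) memv_cap eU'.
  exact: memv_line.
have /choice[p pP] : forall i, exists p : F * K,
    p.1 \in U' /\ u i = p.1 + p.2 *: e.
  move=> i; have : u i \in (U' + <[e]>)%VS.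
    by rewrite addv_diff (addv_idPl eU) uU.
  by case/memv_addP => x xU [y /vlineP[c ->] ->]; exists (x, c).
pose c i := (p i).2; have uE i : u i = (p i).1 + c i *: e by case: (pP i).
have pU i : (p i).1 \in U' by case: (pP i).
have [cc|/existsNP[k ncc]] := pselect (cauchy_seq v c).
  have [c0 cvc] := Q2_complete HK cc.
  have cve : converges_to ord (fun i => c i *: e) (c0 *: e).
    move=> k; have [N hN] := cvc `|k - ord e|; exists N => i /hN.
    move=> /(val_geqZ e); rewrite scalerBl; apply: val_geqW.
    by have := ord2_gt0 Hord; move: (ord 2) (ord e) => o oe; nia.
  have [|||l lU' cvl] := IH U' (fun i => (p i).1) => //.
    move=> k; have [N hN] := cu k; have [N' hN'] := cve k.
    exists (maxn N N') => i j; rewrite !geq_max => /andP[Ni N'i] /andP[Nj N'j].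
    have -> : (p i).1 - (p j).1 =
        u i - u j - ((c i *: e - c0 *: e) - (c j *: e - c0 *: e)).
      by rewrite !uE; ring.
    by apply: (val_geqB VF); [|apply: (val_geqB VF)]; auto.
  exists (l + c0 *: e).
    by rewrite rpredD ?(subvP (diffvSl _ _) _ lU') // memvZ // memv_pick.
  move=> k; have [N hN] := cvl k; have [N' hN'] := cve k.
  exists (maxn N N') => i; rewrite geq_max => /andP[Ni N'i].
  have -> : u i - (l + c0 *: e) = ((p i).1 - l) + (c i *: e - c0 *: e).
    by rewrite uE; ring.
  by apply: valuationD; auto.
have /choice[q qP] : forall N, exists q : nat * nat,
    [/\ (N <= q.1)%N, (N <= q.2)%N & ~ val_geq v (c q.1 - c q.2) k].
  move=> N; move/forallNP: ncc => /(_ N) /existsNP[i /existsNP[j]].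
  by move=> /not_implyP[Ni /not_implyP[Nj h]]; exists (i, j).
pose dc N := c (q N).1 - c (q N).2.
(* Each [w N] is [e] plus a vector of [U'], and [v (dc N) < k] bounds the loss of order in the
   division, so [w] still tends to 0. *)
pose w N := (dc N)^-1 *: (u (q N).1 - u (q N).2).
have dcn0 N : dc N != 0.
  by apply/eqP => h; case: (qP N) => _ _ []; rewrite -/(dc N) h; left.
have cvw : converges_to ord w 0.
  move=> l; have [N hN] := cu (l + ord 2 * k); exists N => i Ni; rewrite subr0.
  have [q1 q2 hq] := qP i.
  have := hN _ _ (leq_trans Ni q1) (leq_trans Ni q2); rewrite /w.
  move: (u _ - u _) => x; have [->|xn0] := eqVneq x 0; first by rewrite scaler0; left.
  case=> [x0|hx]; first by rewrite x0 eqxx in xn0.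
  right; rewrite ordZ ?invr_eq0 // (valuationV (Q2_valuation HK)) //.
  have : v (dc i) < k by rewrite ltNge; apply/negP => h; apply: hq; right.
  by have := ord2_gt0 Hord; move: (ord 2) (v _) hx => o z hx; nia.
have cvs : converges_to ord (fun N => e - w N) e.
  move=> l; have [N hN] := cvw l; exists N => i /hN; rewrite subr0 => h.
  by rewrite addrAC subrr add0r; apply: val_geqN.
have sU N : e - w N \in U'.
  have -> : e - w N = - (dc N)^-1 *: ((p (q N).1).1 - (p (q N).2).1).
    rewrite /w !uE -{1}(scale1r e) -(mulVf (dcn0 N)) -scalerA -scalerBr scaleNr -scalerN.
    by congr (_ *: _); rewrite /dc scalerBl; ring.
  by rewrite memvZ // rpredB.
have [|l lU' cvl] := IH U' _ dU' sU.
  move=> l; have [N hN] := cvs l; exists N => i j /hN hi /hN hj.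
  have -> : e - w i - (e - w j) = (e - w i - e) - (e - w j - e) by ring.
  exact: val_geqB.
by rewrite (converges_unique VF cvs cvl) lU' in eU'.
Qed.

Lemma finite_extension_complete (u : nat -> F) :
  cauchy_seq ord u -> exists l, converges_to ord u l.
Proof.
move=> /(@cauchy_subspace _ fullv u erefl) [i|l _ ?]; first exact: memvf.
by exists l.
Qed.

End Completeness.

(** * The quadratic defect *)

Section ExtendedOrder.
Variables (F : fieldType) (ord : F -> int).
Hypothesis VF : is_valuation ord.
Local Notation ordE := (ordE ord).

Lemma ordE0 : ordE 0 = +oo%E. Proof. by rewrite /ordE eqxx. Qed.

Lemma ordEn0 x : x != 0 -> ordE x = ((ord x)%:Q)%:E.
Proof. by rewrite /ordE => /negPf ->. Qed.

Lemma ordE1 : ordE 1 = 0%E.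
Proof. by rewrite ordEn0 ?oner_eq0 // valuation1. Qed.

Lemma ordEM x y : ordE (x * y) = (ordE x + ordE y)%E.
Proof.
have [->|xn0] := eqVneq x 0.
  by rewrite mul0r ordE0; case: (eqVneq y 0) => [->|/ordEn0 ->]; rewrite ?ordE0.
have [->|yn0] := eqVneq y 0; first by rewrite mulr0 ordE0 ordEn0.
by rewrite !ordEn0 ?mulf_neq0 // (valuationM VF) // rmorphD.
Qed.

Lemma ordEN x : ordE (- x) = ordE x.
Proof.
have [->|xn0] := eqVneq x 0; first by rewrite oppr0.
by rewrite !ordEn0 ?oppr_eq0 // valuationN.
Qed.

Lemma val_geqE x k : val_geq ord x k <-> ((k%:Q)%:E <= ordE x)%E.
Proof.
have [->|xn0] := eqVneq x 0; first by rewrite ordE0 leey; split=> // _; left.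
rewrite ordEn0 // lee_fin ler_int; split=> [[x0|//]|]; last by right.
by rewrite x0 eqxx in xn0.
Qed.

Lemma ordED x y : (Order.min (ordE x) (ordE y) <= ordE (x + y))%E.
Proof.
have [->|xn0] := eqVneq x 0; first by rewrite add0r ge_min lexx orbT.
have [->|yn0] := eqVneq y 0; first by rewrite addr0 ge_min lexx.
have : ((Num.min (ord x) (ord y))%:Q%:E <= ordE (x + y))%E.
  apply/val_geqE/(valuationD VF); right; first by rewrite ge_min lexx.
  by rewrite ge_min lexx orbT.
apply: le_trans; rewrite (ordEn0 xn0) (ordEn0 yn0).
by rewrite ge_min !lee_fin !ler_int; case: (leP (ord x) (ord y)) => _; rewrite lexx ?orbT.
Qed.

Lemma principalP b x : principal ord b x <-> (ordE b <= ordE x)%E.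
Proof.
split=> [[y /val_geqE yO <-]|].
  by rewrite ordEM -[leLHS]adde0 leeD.
have [->|bn0] := eqVneq b 0.
  rewrite ordE0 leye_eq; have [->|xn0] := eqVneq x 0; last by rewrite ordEn0.
  by exists 0; [left | rewrite mulr0].
move=> h; exists (b^-1 * x); last by rewrite mulVKf.
apply/val_geqE; rewrite ordEM ordEn0 ?invr_eq0 // valuationV //.
move: h; rewrite (ordEn0 bn0); case: (ordE x) => //= r.
by rewrite -EFinD !lee_fin rmorphN /=; lra.
Qed.

(** Whichever generator [xget] chooses, two generators of the same ideal have the same order. *)
Lemma ideal_ord_principal b : ideal_ord ord (principal ord b) = ordE b.
Proof.
rewrite /ideal_ord; set P := fun _ => _.
have /(xgetI 0) : P b by [].
rewrite /P => /seteqP[h1 h2]; apply/le_anti/andP; split; apply/principalP.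
  exact/h1/principalP.
exact/h2/principalP.
Qed.

End ExtendedOrder.

Section QuadraticDefect.
Variables (F : fieldType) (ord : F -> int).
Hypothesis VF : is_valuation ord.
Hypothesis complete : forall u, cauchy_seq ord u -> exists l, converges_to ord u l.
Hypothesis two : (2 : F) != 0.
Hypothesis e_gt0 : 0 < ord 2.

Local Notation ordE := (ordE ord).
Local Notation d := (dfct ord).
Local Notation e := (ram ord).

Lemma double_ram : 2 * e = (2 * ord 2)%:~R.
Proof. by rewrite intrM. Qed.

(** The map from [y] to [c - y^2] contracts the maximal ideal, as [y^2 - z^2 = (y - z)(y + z)]; its
    iterates from 0 converge to a root. *)
Lemma artin_schreier_root c : val_geq ord c 1 -> exists y, y ^+ 2 + y = c.
Proof.
move=> c1; pose y := fix y n := if n is n'.+1 then c - y n' ^+ 2 else 0.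
have y1 n : val_geq ord (y n) 1.
  elim: n => [|n IH] /=; first by left.
  apply: (val_geqB VF) => //; apply: val_geqW (val_geqM VF IH IH) => //.
have yS n : val_geq ord (y n.+1 - y n) n.+1.
  elim: n => [|n IH]; first by apply: (val_geqB VF).
  have -> : y n.+2 - y n.+1 = - ((y n.+1 - y n) * (y n.+1 + y n)).
    by rewrite [y n.+2]/= [in LHS]/=; rewrite [in RHS]/=; ring.
  apply: (val_geqN VF); have -> : Posz n.+2 = Posz n.+1 + 1 by lia.
  by apply: (val_geqM VF) => //; apply: (valuationD VF).
have yD n m : (n <= m)%N -> val_geq ord (y m - y n) n.+1.
  move=> /subnK <-; elim: (m - n)%N => [|p IH]; first by left; rewrite subrr.
  have -> : y (p.+1 + n)%N - y n = (y (p + n).+1 - y (p + n)%N) + (y (p + n)%N - y n).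
    by rewrite addSn; ring.
  by apply: (valuationD VF) => //; apply: val_geqW (yS _); lia.
have [k|l cvl] := complete (u := y).
  exists `|k|%N => i j Ni Nj.
  have -> : y i - y j = (y i - y `|k|%N) - (y j - y `|k|%N) by ring.
  by apply: (val_geqB VF); apply: val_geqW (yD _ _ _) => //; lia.
exists l; apply/eqP; rewrite -subr_eq0; apply/eqP/(val_geq_eq0 (v := ord)) => k.
have [N hN] := cvl `|k|; have h0 := hN N (leqnn _); have h1 := hN N.+1 (leqnSn _).
have -> : l ^+ 2 + l - c = (y N - l) * (y N - l - (y N + y N)) - (y N.+1 - l).
  by rewrite /=; ring.
apply: (val_geqB VF); last by apply: val_geqW h1; lia.
apply: (@val_geqW _ _ _ (`|k| + 0)); first lia.
apply: (val_geqM VF) => //; apply: (val_geqB VF); first by apply: val_geqW h0; lia.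
by apply: (valuationD VF); apply: val_geqW (y1 N).
Qed.

(** Putting [s = 1 + 2 y] turns the equation into [y^2 + y = - x / 4], whose right side has positive
    order. *)
Lemma local_square_theorem x :
  ((2 * e)%:E < ordE x)%E -> exists s, 1 - x = s ^+ 2.
Proof.
move=> hx; have [|y yE] := @artin_schreier_root (- x / 4).
  have [->|xn0] := eqVneq x 0; first by left; rewrite oppr0 mul0r.
  have four : (4 : F) = 2 * 2 by ring.
  right; rewrite (valuationM VF) ?oppr_eq0 ?invr_eq0 ?four ?mulf_neq0 //.
  rewrite valuationV ?mulf_neq0 // (valuationM VF) // valuationN //.
  move: hx; rewrite ordEn0 // lte_fin double_ram ltr_int.
  by move: (ord 2) (ord x) => o z; lia.
exists (1 + 2 * y); have -> : x = - (2 * 2 * (y ^+ 2 + y)).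
  rewrite yE (_ : (4 : F) = 2 * 2); last by ring.
  by rewrite mulrC divfK ?opprK ?mulf_neq0.
by ring.
Qed.

(** If some [a - c^2] has order above [ord a + 2e], the local square theorem makes [a] a square and
    the largest value is infinite; otherwise the orders are integers bounded above, so one of them
    is largest. *)
Lemma defect_generator (a : F) : a != 0 ->
  exists c, forall c', (ordE (a - c' ^+ 2) <= ordE (a - c ^+ 2))%E.
Proof.
move=> an0; have [[c hc]|/forallNP hn] :=
    pselect (exists c, (((ord a)%:~R + 2 * e)%:E < ordE (a - c ^+ 2))%E).
  have : ((2 * e)%:E < ordE ((a - c ^+ 2) / a))%E.
    rewrite (ordEM VF) (@ordEn0 _ _ a^-1) ?invr_eq0 // valuationV //.
    case: (ordE _) hc => [r||] //; last by rewrite addye // !ltry.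
    by rewrite -EFinD !lte_fin rmorphN /=; lra.
  move=> /local_square_theorem[s hs].
  have sn0 : s != 0.
    have e0 : 0 < e by rewrite ltr0z.
    apply: contraTneq hc => s0; have c0 : c = 0.
      apply/eqP; rewrite -sqrf_eq0; apply/eqP.
      have -> : c ^+ 2 = a * (1 - (a - c ^+ 2) / a) by field.
      by rewrite hs s0 expr0n mulr0.
    by rewrite c0 expr0n subr0 ordEn0 // lte_fin -leNgt; lra.
  exists (c / s) => c'; have -> : a - (c / s) ^+ 2 = 0; last by rewrite ordE0 leey.
  apply/eqP; rewrite subr_eq0 expr_div_n -hs; apply/eqP.
  have cn0 : c != 0.
    apply: contraNneq sn0 => c0; rewrite -sqrf_eq0 -hs c0 expr0n subr0 divff //.
    by rewrite subrr.
  have -> : 1 - (a - c ^+ 2) / a = c ^+ 2 / a by field.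
  by field; rewrite ?an0 ?cn0.
have hb c : a - c ^+ 2 != 0 /\ ord (a - c ^+ 2) <= ord a + 2 * ord 2.
  have := hn c; have [->|nz] := eqVneq (a - c ^+ 2) 0; first by rewrite ordE0 ltry.
  rewrite ordEn0 // double_ram -intrD lte_fin ltr_int => /negP; rewrite -leNgt.
  by [].
pose g c : int := ord a + 2 * ord 2 - ord (a - c ^+ 2).
have gE c : g c = Posz (absz (g c)).
  by rewrite gez0_abs // /g; have [_] := hb c; lra.
have [|n /asboolP[c cE] nmin] := @ex_minnP (fun n => `[< exists c, g c = Posz n >]).
  by exists (absz (g 0)); apply/asboolP; exists 0.
exists c => c'; rewrite !ordEn0 ?(hb _).1 // lee_fin ler_int.
have : (n <= absz (g c'))%N by apply: nmin; apply/asboolP; exists c'.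
move: (gE c') cE; rewrite /g; move: (ord 2) (ord a) (ord _) (ord _) (absz _).
by move=> o x y z p; lia.
Qed.

(** The working form of the defect: a best approximation by a square makes the intersection of
    ideals principal, so [d a] is an attained maximum. *)
Lemma dfctE (a : F) : a != 0 -> exists c,
  d a = ordE (1 - a^-1 * c ^+ 2) /\
  forall c', (ordE (1 - a^-1 * c' ^+ 2) <= d a)%E.
Proof.
move=> an0; have [c hc] := defect_generator an0; exists c.
have cE x : 1 - a^-1 * x ^+ 2 = a^-1 * (a - x ^+ 2) by field.
have -> : d a = ordE (a^-1 * (a - c ^+ 2)).
  rewrite /dfct -(ideal_ord_principal VF); congr ideal_ord.
  have -> : quadratic_defect ord a = principal ord (a - c ^+ 2).
    apply/seteqP; split=> [x|x /(principalP VF) cx b [c' ab]].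
      by apply; exists c; rewrite addrC subrK.
    apply/(principalP VF); apply: le_trans cx.
    by rewrite (_ : b = a - c' ^+ 2) ?hc // ab addrC addKr.
  apply/seteqP; split=> [_ [_ [y yO <-] <-]|_ [y yO <-]].
    by exists y; rewrite // mulrA.
  by exists ((a - c ^+ 2) * y); [exists y | rewrite mulrA].
by rewrite cE; split=> // x; rewrite cE !(ordEM VF) leeD2l.
Qed.

Lemma dfct_ge0 (a : F) : a != 0 -> (0 <= d a)%E.
Proof.
move=> an0; have [c [_ /(_ 0)]] := dfctE an0.
by rewrite expr0n mulr0 subr0 ordE1.
Qed.

Lemma dfct_mul_square (a s : F) : a != 0 -> s != 0 -> d (a * s ^+ 2) = d a.
Proof.
have le_d (b r : F) : b != 0 -> r != 0 -> (d b <= d (b * r ^+ 2))%E.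
  move=> bn0 rn0; have [c [-> _]] := dfctE bn0.
  have [c' [_ /(_ (c * r))]] := dfctE (mulf_neq0 bn0 (expf_neq0 2 rn0)).
  apply: le_trans; rewrite le_eqVlt; apply/orP; left; apply/eqP; congr ordE.
  by field; rewrite ?bn0 ?rn0.
move=> an0 sn0; apply/le_anti; rewrite le_d // andbT.
apply: le_trans (le_d _ s^-1 _ _) _; rewrite ?mulf_neq0 ?expf_neq0 ?invr_eq0 //.
by rewrite -mulrA -exprMn divff // expr1n mulr1.
Qed.

(** Domination principle. For optimal [x = 1 - c^2 / a] and [y = 1 - c'^2 / b], the product [c c']
    leaves the error [x + (1 - x) y], and [1 - x] is integral because [d a >= 0]. *)
Lemma dfct_mul (a b : F) :
  a != 0 -> b != 0 -> (Order.min (d a) (d b) <= d (a * b))%E.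
Proof.
move=> an0 bn0; have := dfct_ge0 an0.
have [c [-> _]] := dfctE an0; have [c' [-> _]] := dfctE bn0.
have [_ [_ /(_ (c * c'))]] := dfctE (mulf_neq0 an0 bn0).
set x := 1 - a^-1 * _; set y := 1 - b^-1 * _ => le_ab x0.
have -> : Order.min (ordE x) (ordE y) = Order.min (ordE x) (0 + ordE y)%E.
  by rewrite add0e.
apply: le_trans le_ab.
have -> : 1 - (a * b)^-1 * (c * c') ^+ 2 = x + (1 - x) * y.
  by rewrite /x /y; field; rewrite ?an0 ?bn0.
apply: le_trans (ordED VF _ _); rewrite le_min ge_min lexx /= (ordEM VF) ge_min.
apply/orP; right; apply: leeD => //.
by apply: le_trans (ordED VF _ _); rewrite ordE1 // ordEN // le_min lexx.
Qed.

Let e_ge0 : (0 <= (2 * e)%:E)%E.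
Proof. by rewrite lee_fin mulr_ge0 // ler0z ltW. Qed.

Lemma ordE_1B x : (0 < ordE x)%E -> ordE (1 - x) = 0%E.
Proof.
move=> x0; apply/le_anti/andP; split.
  rewrite leNgt; apply: contraTN isT => y0.
  by have := ordED VF (1 - x) x; rewrite subrK ordE1 // ge_min !leNgt x0 y0.
by apply: le_trans (ordED VF _ _); rewrite ordE1 // ordEN // le_min lexx ltW.
Qed.

Lemma dfct_square (a : F) : a != 0 -> ((2 * e)%:E < d a)%E ->
  exists2 s, s != 0 & a = s ^+ 2.
Proof.
move=> an0; have [c [-> _]] := dfctE an0 => h.
have [s] := local_square_theorem h; rewrite opprB addrCA subrr addr0 => cs.
have x0 := le_lt_trans e_ge0 h.
have : 1 - (1 - a^-1 * c ^+ 2) != 0.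
  by apply: contraTneq isT => z; have := ordE_1B x0; rewrite z ordE0.
rewrite opprB addrCA subrr addr0 mulf_eq0 negb_or sqrf_eq0 => /andP[_ cn0].
have sn0 : s != 0 by rewrite -sqrf_eq0 -cs mulf_neq0 ?invr_eq0 ?expf_neq0.
exists (c / s); first by rewrite mulf_neq0 ?invr_eq0.
by rewrite expr_div_n -cs; field; rewrite ?an0 ?cn0.
Qed.

Lemma is_norm_mul (a x y : F) : is_norm a x -> is_norm a y -> is_norm a (x * y).
Proof.
move=> [s [t ->]] [s' [t' ->]].
by exists (s * s' + a * t * t'), (s * t' + t * s'); ring.
Qed.

(* With [a = 1 - x] and [b = 1 - y], the norm [x b] from [1 - x b] is a norm
   from [a], as [1 - x b = a (1 + x y / a)]; so is [x]. *)
Lemma is_norm_1B x y :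
  ((2 * e)%:E < ordE x + ordE y)%E -> is_norm (1 - x) (1 - y).
Proof.
(* An order at most 0 on one side forces the order on the other side above [2e], and that factor is
   a square. *)
move=> xy; have [x0|x0] := leP (ordE x) 0%E.
  have [|s ->] := @local_square_theorem y; last by exists s, 0; ring.
  by apply: lt_le_trans xy _; rewrite -[leRHS]add0e leeD2r.
have [y0|y0] := leP (ordE y) 0%E.
  have h : ((2 * e)%:E < ordE x)%E.
    by apply: lt_le_trans xy _; rewrite -[leRHS]adde0 leeD2l.
  have [s sE] := local_square_theorem h.
  rewrite sE; apply: is_norm_square => //; apply: contraTneq isT => s0.
  by have := ordE_1B x0; rewrite sE s0 expr0n ordE0.
have a0 := ordE_1B x0; set a := 1 - x in a0 *; set b := 1 - y.
have an0 : a != 0 by apply: contraTneq isT => z; move: a0; rewrite z ordE0.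
have [xz|xn0] := eqVneq x 0.
  by rewrite /a xz subr0 -(expr1n _ 2); apply: is_norm_square; rewrite ?oner_eq0.
have [|s sE] := @local_square_theorem (- (x * y / a)).
  rewrite ordEN // !(ordEM VF) (_ : ordE a^-1 = 0%E) ?adde0 //.
  rewrite ordEn0 ?invr_eq0 // valuationV //; move: a0; rewrite ordEn0 // => -[].
  by rewrite rmorphN /= => ->; rewrite oppr0.
have sa : 1 - x * b = a * s ^+ 2 by rewrite -sE /b /a; field.
have sn0 : s != 0.
  apply: contraTneq isT => s0; have : (0 < ordE (x * b))%E.
    by rewrite (ordEM VF) ordE_1B ?adde0.
  by move/ordE_1B; rewrite sa s0 expr0n mulr0 ordE0.
have n1 : is_norm a x by exists 1, 1; rewrite /a; ring.
have n2 : is_norm a (x * b).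
  have : is_norm (1 - x * b) (x * b) by exists 1, 1; ring.
  rewrite sa => /(is_norm_scale 1 (invr_neq0 sn0)).
  by rewrite (_ : a * s ^+ 2 * _ = a) ?expr1n ?mulr1 //; field.
have -> : b = x * (x * b) * x^-1 ^+ 2 by field.
rewrite -[a]mulr1 -(expr1n _ 2); apply: is_norm_scale (is_norm_mul n1 n2).
by rewrite oner_eq0.
Qed.

(** Up to squares, [a] is [1 - x] and [b] is [1 - y] with [x], [y] of orders [d a], [d b]. When an
    optimal approximation is 0 this normalization fails, but then that defect is 0 and the other
    number is a square. *)
Lemma dfct_is_norm (a b : F) : a != 0 -> b != 0 ->
  ((2 * e)%:E < d a + d b)%E -> is_norm a b.
Proof.
move=> an0 bn0; have [c [dc _]] := dfctE an0; have [c' [dc' _]] := dfctE bn0.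
have [c0|cn0] := eqVneq c 0.
  rewrite dc c0 expr0n mulr0 subr0 ordE1 // add0e => /(dfct_square bn0)[s _ ->].
  by exists s, 0; ring.
have [c0|cn0'] := eqVneq c' 0.
  rewrite dc' c0 expr0n mulr0 subr0 ordE1 // adde0 => /(dfct_square an0)[s sn0 ->].
  exact: is_norm_square.
rewrite dc dc' => /is_norm_1B; rewrite !opprB ![1 + _]addrC !subrK.
move=> /(is_norm_scale (b / c') (mulf_neq0 an0 (invr_neq0 cn0))).
rewrite (_ : _ * (a / c) ^+ 2 = a); last by field; rewrite ?cn0 ?an0.
by rewrite (_ : _ * (b / c') ^+ 2 = b) //; field; rewrite ?cn0' ?bn0.
Qed.

End QuadraticDefect.

(** * Gram matrices and BONGs *)

Section GramMatrices.
Variable F : fieldType.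
Implicit Types V W : formSpace F.

Lemma bilC V (x y : V) : bil x y = bil y x.
Proof. by rewrite /bil hermC mul1r. Qed.

Lemma bilDl V (x y z : V) : bil (x + y) z = bil x z + bil y z.
Proof. exact: linearDl. Qed.

Lemma bilZl V c (x y : V) : bil (c *: x) y = c * bil x y.
Proof. by rewrite /bil linearZl_LR. Qed.

Lemma bilDr V (x y z : V) : bil z (x + y) = bil z x + bil z y.
Proof. exact: linearDr. Qed.

Lemma bilZr V c (x y : V) : bil y (c *: x) = c * bil y x.
Proof. by rewrite bilC bilZl bilC. Qed.

Lemma bil_suml V n (x : 'I_n -> V) y : bil (\sum_i x i) y = \sum_i bil (x i) y.
Proof. by rewrite /bil linear_sumlz. Qed.

Lemma bil_sumr V n (x : 'I_n -> V) y : bil y (\sum_i x i) = \sum_i bil y (x i).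
Proof. by rewrite bilC bil_suml; apply: eq_bigr => i _; rewrite bilC. Qed.

(* [A] is the Gram matrix of [V] in some basis, given as an isomorphism from
   the coordinate space. *)
Definition is_gram n V (A : 'M[F]_n) : Prop :=
  exists2 f : {linear 'rV[F]_n -> V}, bijective f &
    forall x y, bil (f x) (f y) = (x *m A *m y^T) 0 0.

Lemma mx_form_delta n (A : 'M[F]_n) i j :
  (delta_mx (0 : 'I_1) i *m A *m (delta_mx (0 : 'I_1) j)^T) 0 0 = A i j.
Proof. by rewrite -rowE trmx_delta -colE !mxE. Qed.

Lemma is_gram_sym n V (A : 'M[F]_n) : is_gram V A -> A^T = A.
Proof.
move=> [f _ fA]; apply/matrixP => i j; rewrite mxE.
by rewrite -2![A _ _]mx_form_delta -!fA bilC.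
Qed.

Lemma is_gram_unit n V (A : 'M[F]_n) : is_gram V A -> nondeg V -> A \in unitmx.
Proof.
move=> [f [g fK gK] fA] /eqP nd; rewrite -row_free_unit -kermx_eq0.
apply/rowV0Pn => -[x /sub_kermxP xA xn0]; case/eqP: xn0.
rewrite -[x]fK; have : f x \in orthov (fs_form V) fullv.
  apply/mem_orthovP => y _; rewrite -[y]gK [LHS]fA xA mul0mx mxE //.
by rewrite nd memv0 => /eqP ->; rewrite -(raddf0 f) fK.
Qed.

(** From a matrix back to an embedding, injectivity comes from [P *m A *m P^T] being the invertible
    [B]. *)
Lemma embeds_gram k n V W (A : 'M[F]_n) (B : 'M[F]_k) :
  is_gram V A -> is_gram W B -> B \in unitmx -> embeds W V <-> mx_repr A B.
Proof.
move=> [f [f' fK f'K] fA] [g [g' gK g'K] gB] Bu.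
have f'_lin : linear f' by apply: can2_linear fK f'K.
have g'_lin : linear g' by apply: can2_linear gK g'K.
split=> [[h _ hE]|[P PB]].
  pose P : 'M[F]_(k, n) := \matrix_i f' (h (g (delta_mx 0 i))).
  have fP x : f (x *m P) = h (g x).
    rewrite mulmx_sum_row [in RHS](row_sum_delta x) !linear_sum /=.
    by apply: eq_bigr => i _; rewrite rowK !linearZ /= f'K.
  exists P; apply/matrixP => i j.
  rewrite -[RHS]mx_form_delta -gB -[LHS]mx_form_delta; rewrite /bil -hE -!fP.
  by rewrite [RHS]fA trmx_mul !mulmxA.
pose h w := f (g' w *m P).
have h_lin : linear h by move=> c x y; rewrite /h g'_lin mulmxDl -scalemxAl linearP.
pose H := HB.pack_for {linear W -> V} h (GRing.isLinear.Build _ _ _ _ h h_lin).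
have hE x y : bil (h x) (h y) = bil x y.
  by rewrite fA trmx_mul !mulmxA -[_ *m P *m A]mulmxA -[_ *m _ *m P^T]mulmxA PB -gB !g'K.
exists H; last by move=> x y; apply: hE.
move=> x y /(can_inj fK) /(congr1 (fun z => z *m A *m P^T)).
rewrite -!mulmxA [P *m _]mulmxA PB => /(congr1 (mulmx^~ (invmx B))).
by rewrite !mulmxK // => /(can_inj g'K).
Qed.

Lemma is_gram_exists n V : \dim {:V} = n ->
  exists2 A : 'M[F]_n, is_gram V A & \det A = gram_det V.
Proof.
move=> <-; eexists; last reflexivity.
set A := (X in is_gram V X); set e := vbasis {:V}.
pose f (x : 'rV[F]_(\dim {:V})) : V := \sum_j x 0 j *: e`_j.
have f_lin : linear f.
  move=> c x y; rewrite /f scaler_sumr -big_split /=; apply: eq_bigr => j _.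
  by rewrite !mxE scalerDl scalerA.
pose H := HB.pack_for {linear 'rV[F]_(\dim {:V}) -> V} f
  (GRing.isLinear.Build _ _ _ _ f f_lin).
exists H.
  exists (fun v => \row_j coord e j v) => [x|v].
    apply/rowP => j; rewrite mxE coord_sum_free //.
    exact: basis_free (vbasisP _).
  rewrite /= /f [RHS](coord_vbasis (memvf v)).
  by apply: eq_bigr => j _; rewrite mxE.
move=> x y; rewrite /= /f bil_suml mxE.
under eq_bigr do rewrite bilZl bil_sumr mulr_sumr.
rewrite exchange_big /=; apply: eq_bigr => j _.
rewrite !mxE mulr_suml; apply: eq_bigr => i _.
by rewrite bilZr !mxE; ring.
Qed.

Definition diag_gram (a : nat -> F) n : 'M[F]_n := diag_mx (\row_j a j.+1).

Lemma diag_gramE (a : nat -> F) n (x y : 'rV[F]_n) :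
  (x *m diag_gram a n *m y^T) 0 0 = \sum_(j < n) a j.+1 * x 0 j * y 0 j.
Proof.
rewrite mxE; apply: eq_bigr => j _; rewrite mul_mx_diag !mxE.
by rewrite [a _ * _]mulrC.
Qed.

Lemma is_gram_diag (a : nat -> F) n : is_gram (diag_space a n) (diag_gram a n).
Proof.
exists idfun; first by exists idfun.
by move=> x y; rewrite diag_gramE.
Qed.

Lemma det_diag_gram (a : nat -> F) n : \det (diag_gram a n) = prefix_prod a n.
Proof.
rewrite det_diag /prefix_prod big_add1 big_mkord; apply: eq_bigr => j _.
by rewrite mxE.
Qed.

End GramMatrices.

(** * BONGs as orthogonal bases *)

Section Bongs.
Variables (F : fieldType) (ord : F -> int) (V : formSpace F).
Implicit Types (L : set V) (x y : V) (xs : seq V).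
Local Open Scope classical_set_scope.

Lemma bil_proj_perp x y : quad x != 0 -> bil x (proj_perp x y) = 0.
Proof.
move=> xn0; rewrite /proj_perp -scaleNr bilDr bilZr -/(quad x).
by rewrite mulNr divfK // subrr.
Qed.

Lemma bong_neq0 L xs x : bong ord L xs -> x \in xs -> quad x != 0.
Proof.
elim: xs L => //= y xs IH L [_ yn0 Lxs]; rewrite inE => /predU1P[-> //|].
exact: IH Lxs.
Qed.

(** Later BONG vectors lie in successive projections of [L] rather than in [L], but a projection
    only subtracts a multiple of an earlier vector, so linear conditions pass to them. Applied to
    orthogonality and to membership in an image. *)
Lemma bong_closed L xs (P : V -> Prop) :
  (forall c x y, P x -> P y -> P (c *: x + y)) -> (forall x, L x -> P x) ->
  bong ord L xs -> forall x, x \in xs -> P x.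
Proof.
move=> Plin; elim: xs L => //= x xs IH L LP [[Lx _] xn0 Lxs] y.
rewrite inE => /predU1P[->|]; first exact: LP.
apply: IH Lxs _ => _ [z Lz <-]; rewrite /proj_perp addrC -scaleNr.
by apply: Plin; apply: LP.
Qed.

Lemma bong_orthogonal L xs : bong ord L xs -> pairwise (fun x y => bil x y == 0) xs.
Proof.
elim: xs L => //= x xs IH L [_ xn0 Lxs]; rewrite (IH _ Lxs) andbT.
apply/allP => y yxs; apply/eqP; move: y yxs.
apply: (bong_closed (P := fun y => bil x y = 0)) Lxs => [c y z xy xz|_ [y _ <-]].
  by rewrite bilDr bilZr xy xz mulr0 addr0.
exact: bil_proj_perp.
Qed.

Lemma bong_span L xs x : bong ord L xs -> L x -> x \in <<xs>>%VS.
Proof.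
elim: xs L x => [|y xs IH] L x /=; first by move=> -> ->; rewrite mem0v.
move=> [_ yn0 Lxs] Lx; rewrite span_cons.
have : proj_perp y x \in <<xs>>%VS by apply: IH Lxs _; exists x.
rewrite /proj_perp => h; rewrite -[x](subrK ((bil y x / quad y) *: y)) addrC.
by rewrite memv_add // memvZ // memv_line.
Qed.

Lemma bil_bong L xs i j : bong ord L xs -> (i < size xs)%N -> (j < size xs)%N ->
  i != j -> bil xs`_i xs`_j = 0.
Proof.
move=> /bong_orthogonal /(pairwiseP 0) h si sj.
rewrite neq_ltn => /orP[ij|ji]; first by apply/eqP/h.
by rewrite bilC; apply/eqP/h.
Qed.

(** A BONG is an orthogonal basis of [FL], so the coordinate map [phi] identifies [[a_1, ..., a_n]]
    with [FL]; [psi] is [phi] followed by the inverse of [f]. *)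
Lemma is_gram_bong (L : set V) n (a : nat -> F) (W : formSpace F) :
  good_bong ord L n a -> isometric_to_subspace W (fspan L) ->
  is_gram W (diag_gram a n).
Proof.
move=> [xs [sx Lxs axs _]] [f [f_inj fE fL]]; subst n.
set n := size xs in axs *.
pose phi (x : 'rV[F]_n) : V := \sum_j x 0 j *: xs`_j.
have phiE (x y : 'rV[F]_n) : bil (phi x) (phi y) = \sum_(j < n) a j.+1 * x 0 j * y 0 j.
  rewrite /phi bil_suml; apply: eq_bigr => j _; rewrite bilZl bil_sumr (bigD1 j) //=.
  rewrite big1 => [|i ij]; last by rewrite bilZr (bil_bong Lxs) ?mulr0 // eq_sym.
  by rewrite bilZr addr0 axs ?ltn_ord //= /quad; ring.
have fspanP v : (exists w, f w = v) <-> fspan L v.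
  rewrite -fL; split=> [[w <-]|[w _ <-]]; last by exists w.
  by exists w.
have f_phi (x : 'rV[F]_n) : exists w, f w = phi x.
  rewrite /phi; have : forall i, (i < n)%N -> exists w, f w = xs`_i.
    move=> i ni; have := mem_nth 0 ni.
    apply: (bong_closed (P := fun v => exists w, f w = v)) Lxs _.
      by move=> c _ _ [w <-] [w' <-]; exists (c *: w + w'); rewrite linearP.
    by move=> y Ly; apply/fspanP; exists 1, y; rewrite scale1r.
  move=> /(_ _ _)h; elim/big_ind: _ => [|_ _ [w <-] [w' <-]|j _].
  - by exists 0; rewrite raddf0.
  - by exists (w + w'); rewrite linearD.
  - by have [w <-] := h j (ltn_ord j); exists (x 0 j *: w); rewrite linearZ.
have phi_f w : exists x : 'rV[F]_n, phi x = f w.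
  have [c [y [Ly ->]]] : fspan L (f w) by apply/fspanP; exists w.
  have /(coord_span (X := in_tuple xs)) yE := bong_span Lxs Ly.
  exists (\row_j (c * coord (in_tuple xs) j y)); rewrite [in RHS]yE scaler_sumr.
  by apply: eq_bigr => j _; rewrite mxE scalerA.
have [psi psiP] := choice f_phi; have [g gP] := choice phi_f.
have phi_lin : linear phi.
  move=> c x y; rewrite /phi scaler_sumr -big_split /=; apply: eq_bigr => j _.
  by rewrite !mxE scalerDl scalerA.
have psi_lin : linear psi.
  by move=> c x y; apply: f_inj; rewrite linearP !psiP phi_lin.
pose H := HB.pack_for {linear 'rV[F]_n -> W} psi
  (GRing.isLinear.Build _ _ _ _ psi psi_lin).
exists H; last by move=> x y; rewrite diag_gramE -phiE -!psiP /bil fE.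
have psiK w : psi (g w) = w by apply: f_inj; rewrite psiP gP.
exists g => //= x.
have phi_inj (y : 'rV[F]_n) :phi y = 0 -> y = 0.
  move=> y0; apply/rowP => j; rewrite mxE.
  have := phiE y (delta_mx 0 j); rewrite y0 -(scale0r 0) bilZl mul0r.
  rewrite (bigD1 j) //= big1 => [|i ij]; last by rewrite mxE (negPf ij) andbF mulr0.
  rewrite mxE !eqxx mulr1 addr0 => /esym/eqP; rewrite mulf_eq0 axs ?ltn_ord //=.
  by rewrite (negPf (bong_neq0 Lxs (mem_nth _ _))) // => /eqP.
apply/eqP; rewrite -subr_eq0; apply/eqP/phi_inj.
rewrite -[g (psi x) - x]addrC -scaleN1r phi_lin gP psiP scaleN1r.
by rewrite addrC subrr.
Qed.

Lemma good_bong_neq0 L n (a : nat -> F) i :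
  good_bong ord L n a -> (1 <= i <= n)%N -> a i != 0.
Proof.
move=> [xs [sx Lxs axs _]] hi; rewrite axs //.
by apply: bong_neq0 Lxs _; apply: mem_nth; rewrite sx; lia.
Qed.

End Bongs.

Section BongSteps.
Variables (F : fieldType) (ord : F -> int).
Hypothesis VF : is_valuation ord.
Hypothesis complete : forall u, cauchy_seq ord u -> exists l, converges_to ord u l.
Hypothesis two : (2 : F) != 0.
Hypothesis e_gt0 : 0 < ord 2.
Variable V : formSpace F.
Implicit Types (L : set V) (x y : V).
Local Open Scope classical_set_scope.

(** This part of being a lattice passes to projections, as the induction along a BONG requires. *)
Definition add_closed L := forall x y, L x -> L y -> L (x + y).

Lemma lattice_add_closed L : is_lattice ord L -> add_closed L.
Proof.
move=> [[s ->] _] _ _ [c cO <-] [c' c'O <-].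
exists (fun i => c i + c' i) => [i|]; first exact: (valuationD VF) (cO i) (c'O i).
by rewrite -big_split; apply: eq_bigr => i _; rewrite scalerDl.
Qed.

Lemma proj_perp_add_closed L x : add_closed L -> add_closed (proj_perp x @` L).
Proof.
move=> La _ _ [y Ly <-] [z Lz <-]; exists (y + z); first exact: La.
by rewrite /proj_perp bilDr mulrDl scalerDl opprD addrACA.
Qed.

Lemma norm_generator_quad L x y : norm_generator ord L x -> L y ->
  exists2 w, ring_of_integers ord w & quad y = quad x * w.
Proof.
move=> [_ nE] Ly; have : norm_ideal ord L (quad y).
  by apply: sub_gen_smallest; exists y.
by rewrite nE => -[w wO <-]; exists w.
Qed.

(* A preimage [z] of [y] in [L] is [y + t x]; both bounds express that [Q z] and
   [Q (z + x)] lie in the norm ideal, generated by [Q x]. *)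
Lemma norm_generator_step L x y :
  add_closed L -> norm_generator ord L x -> quad x != 0 ->
  (proj_perp x @` L) y -> exists t w, [/\ ring_of_integers ord w,
    ring_of_integers ord (2 * t) & quad y = quad x * (w - t ^+ 2)].
Proof.
move=> La xL xn0 [z Lz zy]; have [w wO zE] := norm_generator_quad xL Lz.
have [w' w'O zxE] := norm_generator_quad xL (La _ _ Lz xL.1).
have xy : bil x y = 0 by rewrite -zy bil_proj_perp.
pose t := bil x z / quad x; have {}zy : z = y + t *: x by rewrite -zy subrK.
have xz : bil x z = t * quad x by rewrite divfK.
have e1 : quad z = quad y + t ^+ 2 * quad x.
  by rewrite zy /quad !(bilDl, bilDr, bilZl, bilZr) (bilC y x) xy; ring.
have e2 : quad (z + x) = quad z + 2 * (t * quad x) + quad x.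
  by rewrite -xz /quad !(bilDl, bilDr) (bilC z x); ring.
exists t, w; split=> //.
  have -> : 2 * t = w' - (w + 1).
    apply: (mulfI xn0).
    have -> : quad x * (w' - (w + 1)) = quad x * w' - quad x * w - quad x by ring.
    by rewrite -zE -zxE e2; ring.
  apply: (val_geqB VF) => //; apply: (valuationD VF) => //.
  by right; rewrite valuation1.
by rewrite mulrBr -zE e1; ring.
Qed.

(** From [b = a (w - t^2)]: approximating [- a b] by the square of [a t] leaves the relative error
    [w a / b], which bounds the defect from below; and [4 b / a = 4 w - (2 t)^2] is integral. *)
Lemma bong_step L x y xs : add_closed L -> bong ord L (x :: y :: xs) ->
  let a := quad x in let b := quad y in
  (0 <= ((ord b)%:Q - (ord a)%:Q)%:E + dfct ord (- a * b))%E /\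
  - (2 * ram ord) <= (ord b)%:Q - (ord a)%:Q.
Proof.
move=> La [xL an0 [[xy _] bn0 _]] a b; rewrite -/a in an0; rewrite -/b in bn0.
have [t [w [wO tO bE]]] := norm_generator_step La xL an0 xy.
rewrite -/a -/b in bE; split.
  have [|_ [_ /(_ (a * t))]] := @dfctE _ _ VF complete two e_gt0 (- a * b).
    by rewrite mulf_neq0 ?oppr_eq0.
  have -> : 1 - (- a * b)^-1 * (a * t) ^+ 2 = w * (a / b).
    have wE : w = b / a + t ^+ 2 by rewrite bE; field.
    by rewrite wE; field; rewrite oppr_eq0 an0 bn0.
  rewrite !(ordEM VF) (ordEn0 _ an0) (@ordEn0 _ _ b^-1) ?invr_eq0 // valuationV //.
  move/(val_geqE ord): wO; case: (ordE _ w) => [r||] //; case: (dfct _ _) => [s||] //;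
    rewrite ?addye ?addey ?leye_eq -?EFinD ?lee_fin ?rmorphN //=; lra.
have : val_geq ord (2 * 2 * (b / a)) 0.
  have -> : 2 * 2 * (b / a) = 2 * 2 * w - (2 * t) * (2 * t) by rewrite bE; field.
  have O2 : val_geq ord 2 0 by right; apply: ltW.
  apply: (val_geqB VF); rewrite -[0]addr0; apply: (val_geqM VF) => //.
  by rewrite -[0]addr0; apply: (val_geqM VF).
case=> [/eqP|]; first by rewrite !mulf_eq0 invr_eq0 !(negPf two) (negPf an0) (negPf bn0).
rewrite !(valuationM VF) ?mulf_neq0 ?invr_eq0 // valuationV //.
rewrite -(ler_int rat) !rmorphD /= rmorphN /= /ram; lra.
Qed.

Lemma good_bong_step L n (a : nat -> F) i : is_lattice ord L ->
  good_bong ord L n a -> (1 <= i < n)%N ->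
  (0 <= (Rinv ord a i.+1 - Rinv ord a i)%:E + dfct ord (- a i * a i.+1))%E /\
  - (2 * ram ord) <= Rinv ord a i.+1 - Rinv ord a i.
Proof.
move=> /lattice_add_closed + [xs [sx + axs _]] hi; rewrite /Rinv !axs; try lia.
case: i hi => // i /=; rewrite -sx; move: {axs sx n} i => i.
elim: xs L i => // x [//|y xs] IH L [|i] hi La Lxs.
  exact: bong_step La Lxs.
case: Lxs => _ _ Lxs; apply: IH Lxs => //.
exact: proj_perp_add_closed.
Qed.

End BongSteps.

(** * The invariants alpha *)

Section BigMin.
Variable G : nat -> \bar rat.

Lemma le_bigmin_nat c m n : (forall j, (m <= j < n)%N -> (c <= G j)%E) ->
  (c <= \big[Order.min/+oo%E]_(m <= j < n) G j)%E.
Proof.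
move=> cG; rewrite big_nat_cond; apply: (big_ind (fun x => (c <= x)%E)).
- exact: leey.
- by move=> x y cx cy; rewrite le_min cx.
- by move=> j; rewrite andbT => /cG.
Qed.

Lemma bigmin_nat_le m n j : (m <= j < n)%N ->
  (\big[Order.min/+oo%E]_(m <= j < n) G j <= G j)%E.
Proof.
rewrite -mem_index_iota; elim: (index_iota m n) => // i s IH.
rewrite inE big_cons ge_min => /predU1P[->|/IH ->]; first by rewrite lexx.
by rewrite orbT.
Qed.

End BigMin.

Section GoodSequences.
Variables (F : fieldType) (ord : F -> int).
Local Notation d := (dfct ord).
Local Notation e := (ram ord).
Local Notation R := (Rinv ord).

(** What the later arguments retain of a lattice with a good BONG; from here on they concern
    sequences. *)
Definition good_seq n (a : nat -> F) : Prop :=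
  [/\ forall i, (1 <= i <= n)%N -> a i != 0,
      forall i, (1 <= i < n)%N ->
        (0 <= (R a i.+1 - R a i)%:E + d (- a i * a i.+1))%E /\
        - (2 * e) <= R a i.+1 - R a i &
      forall i, (1 <= i)%N -> (i.+2 <= n)%N -> R a i <= R a i.+2].

Section OneSequence.
Variables (n : nat) (a : nat -> F).

(* The terms of [alpha_i] with [j < i] and with [j > i] are terms of
   [alpha_(i-1)] and [alpha_(i+1)], shifted by [R_(i+1) - R_i]. *)
Lemma alpha_neighbours i : (1 <= i < n)%N ->
  (Order.min ((R a i.+1 - R a i) / 2 + e)%:E
     ((R a i.+1 - R a i)%:E + Order.min (d (- a i * a i.+1))
        (Order.min (alpha_ign ord n a i.-1) (alpha_ign ord n a i.+1)))
   <= alpha ord n a i)%E.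
Proof.
move=> hi; rewrite /alpha le_min ge_min lexx /= ge_min; apply/orP; right.
set dR := R a i.+1 - R a i; set z := Order.min (d _) _.
have shift (r : rat) (x : \bar rat) : (z <= (r - dR)%:E + x -> dR%:E + z <= r%:E + x)%E.
  case: x z => [x||] [z||] //; rewrite ?addey ?addye ?addeNy ?leNye ?leey -?EFinD ?lee_fin //.
  by lra.
rewrite le_min; apply/andP; split; apply: le_bigmin_nat => j hj; apply: shift.
- have [ji|ij] := ltnP j i.
    have -> : R a i.+1 - R a j - dR = R a i - R a j by rewrite /dR; lra.
    apply: le_trans (_ : alpha_ign ord n a i.-1 <= _)%E.
      by rewrite !ge_min lexx !orbT.
    rewrite /alpha_ign ifT; last lia.
    have -> : i = i.-1.+1 by lia.
    rewrite /alpha !ge_min; apply/orP; right; apply/orP; left.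
    pose G j := ((R a i.-1.+1 - R a j)%:E + d (- a j * a j.+1)%R)%E.
    by rewrite /= (@bigmin_nat_le G _ _ j) //; lia.
  have -> : j = i by lia.
  by rewrite subrr add0e ge_min lexx.
- have [ij|ji] := ltnP i j.
    have -> : R a j.+1 - R a i - dR = R a j.+1 - R a i.+1 by rewrite /dR; lra.
    apply: le_trans (_ : alpha_ign ord n a i.+1 <= _)%E.
      by rewrite !ge_min lexx !orbT.
    rewrite /alpha_ign ifT; last lia.
    rewrite /alpha !ge_min; apply/orP; right; apply/orP; right.
    pose G j := ((R a j.+1 - R a i.+1)%:E + d (- a j * a j.+1)%R)%E.
    by rewrite (@bigmin_nat_le G _ _ j) //; lia.
  have -> : j = i by lia.
  by rewrite subrr add0e ge_min lexx.
Qed.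

(* The first alternative lets the [i]-th approximation be compared with the
   original space through a common subspace, the second through a common
   overspace. *)
Lemma alpha_dichotomy i (x y : \bar rat) : (1 <= i < n)%N ->
  (0 <= x -> 0 <= y ->
   x <= alpha_ign ord n a i.-1 -> y <= alpha_ign ord n a i.+1 ->
   Order.min x y <= d (- a i * a i.+1)%R ->
   (2 * e + R a i - R a i.+1)%:E < x + y ->
   (2 * e)%:E < alpha ord n a i + x \/ (2 * e)%:E < alpha ord n a i + y)%E.
Proof.
move=> hi x0 y0 xa ya dxy xy; have := alpha_neighbours hi.
set dR := R a i.+1 - R a i; set z := Order.min (d _) _.
(* Let [dR = R_{i+1} - R_i]. If [alpha_i >= dR / 2 + e], then [2 alpha_i + x + y > 4e]; if
   [alpha_i >= dR + z], then [z >= min(x, y)] gives [alpha_i + max(x, y) > 2e]. *)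
have : (Order.min x y <= z)%E.
  by rewrite !le_min dxy !ge_min xa ya orbT.
have : ((2 * e - dR)%:E < x + y)%E by apply: le_lt_trans xy; rewrite lee_fin /dR; lra.
move: (alpha _ _ _ _) z x0 y0 {xa ya dxy xy} => A z x0 y0 xy.
move=> h1; have : (0 <= z)%E by apply: le_trans h1; rewrite le_min x0.
move: h1; rewrite !ge_min => /orP h1 z0 /orP h2.
suff : ((2 * e)%:E < A + x)%E || ((2 * e)%:E < A + y)%E by move/orP.
have xN : x != -oo%E by case: (x) x0.
case: z h1 z0 h2 => [z||] // h1 z0 h2; case: A h2 => [A||] //; try by case.
- move=> h2; case: x x0 xy h1 {xN} => [x||] // x0; last by rewrite !addey // !ltry.
  case: y y0 => [y||] // y0; last by rewrite !addey // !ltry orbT.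
  rewrite -!EFinD !lte_fin !lee_fin in h2 * => xy h1.
  by case: (ltP (2 * e) (A + x)) => //= ?; case: h1; case: h2; lra.
- by move=> _; rewrite (addye xN) ltry.
- rewrite addey // leye_eq lee_fin => -[] // h2.
  case: x x0 xy {h1 xN} => [x||] // x0; last by rewrite !addey // !ltry.
  case: y y0 => [y||] // y0; last by rewrite !addey // !ltry orbT.
  rewrite -!EFinD !lte_fin => xy.
  by case: (ltP (2 * e) (A + x)) => //= ?; lra.
- by move=> _; rewrite (addye xN) ltry.
Qed.

Hypothesis ga : good_seq n a.

Lemma good_seq_neq0 i : (1 <= i <= n)%N -> a i != 0.
Proof. by case: ga => h _ _; exact: h. Qed.

Lemma prefix_prod_neq0 i : (i <= n)%N -> prefix_prod a i != 0.
Proof.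
move=> ni; rewrite /prefix_prod prodf_seq_neq0; apply/allP => j.
rewrite mem_index_iota => hj; apply: good_seq_neq0; lia.
Qed.

Lemma good_seq_even i k : (1 <= i)%N -> (i + k.*2 <= n)%N -> R a i <= R a (i + k.*2)%N.
Proof.
move=> i1; elim: k => [|k IH] hk; first by rewrite addn0.
have [_ _ /(_ (i + k.*2)%N)h] := ga.
by rewrite doubleS !addnS (le_trans (IH _)) ?h //; lia.
Qed.

Hypothesis VF : is_valuation ord.
Hypothesis complete : forall u, cauchy_seq ord u -> exists l, converges_to ord u l.
Hypothesis two : (2 : F) != 0.
Hypothesis e_gt0 : 0 < ord 2.

Lemma dfct_step_ge0 i : (1 <= i < n)%N -> (0 <= d (- a i * a i.+1))%E.
Proof.
move=> hi; apply: (dfct_ge0 VF complete two e_gt0).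
by rewrite mulf_neq0 ?oppr_eq0 ?good_seq_neq0 //; lia.
Qed.

(** Each defect term of [alpha_i] is at least 0 and at least [R_{i+1} - R_i]. Goodness compares
    indices two apart, so the parity of [i - j] decides whether [R_j, R_{j+1}] are compared with
    [R_i, R_{i+1}] in this order or crosswise. *)
Lemma alpha_ge i (c : rat) : (1 <= i < n)%N ->
  c <= (R a i.+1 - R a i) / 2 + e -> (c <= 0) || (c <= R a i.+1 - R a i) ->
  (c%:E <= alpha ord n a i)%E.
Proof.
move=> hi c1 c2.
have even p q : (1 <= p)%N -> (p <= q <= n)%N -> ~~ odd (q - p)%N -> R a p <= R a q.
  move=> p1 pq par; have := @good_seq_even p (q - p)./2 p1.
  have /subnKC pqK : (p <= q)%N by lia.
  by rewrite even_halfK // pqK; apply => //; lia.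
have [_ ga1 _] := ga.
rewrite /alpha !le_min lee_fin c1 /=; apply/andP; split;
  apply: le_bigmin_nat => j hj; have hj' : (1 <= j < n)%N by lia.
- have [s1 _] := ga1 _ hj'; have d0 := dfct_step_ge0 hj'.
  have m12 : (R a j <= R a i /\ R a j.+1 <= R a i.+1) \/
                 (R a j <= R a i.+1 /\ R a j.+1 <= R a i).
    have [par|par] := boolP (odd (i - j)%N); [right | left]; split; apply: even; lia.
  case: (d _) s1 d0 => [r||] //; last by rewrite !addey // !leey.
  by rewrite -!EFinD !lee_fin; move: c2 m12 => /orP[] ? [[] | []] ? ?; lra.
- have [s1 _] := ga1 _ hj'; have d0 := dfct_step_ge0 hj'.
  have m12 : (R a i <= R a j /\ R a i.+1 <= R a j.+1) \/
                 (R a i <= R a j.+1 /\ R a i.+1 <= R a j).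
    have [par|par] := boolP (odd (j - i)%N); [right | left]; split; apply: even; lia.
  case: (d _) s1 d0 => [r||] //; last by rewrite !addey // !leey.
  by rewrite -!EFinD !lee_fin; move: c2 m12 => /orP[] ? [[] | []] ? ?; lra.
Qed.

Lemma alpha_ge0 i : (1 <= i < n)%N -> (0 <= alpha ord n a i)%E.
Proof.
move=> hi; apply: alpha_ge; rewrite ?lexx //.
by have [_ /(_ _ hi)[_ +] _] := ga; lra.
Qed.

Lemma alpha_gt_2e i : (1 <= i < n)%N -> 2 * e < R a i.+1 - R a i ->
  ((2 * e)%:E < alpha ord n a i)%E.
Proof.
move=> hi h; set dR := R a i.+1 - R a i in h.
apply: (@lt_le_trans _ _ (Num.min (dR / 2 + e) dR)%:E).
  by rewrite lte_fin lt_min; lra.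
by apply: alpha_ge; rewrite ?ge_min ?lexx ?orbT.
Qed.

End OneSequence.
End GoodSequences.

(** * Approximations *)

Section Approximations.
Variables (F : fieldType) (ord : F -> int).
Hypothesis VF : is_valuation ord.
Hypothesis complete : forall u, cauchy_seq ord u -> exists l, converges_to ord u l.
Hypothesis two : (2 : F) != 0.
Hypothesis e_gt0 : 0 < ord 2.

Local Notation d := (dfct ord).
Local Notation e := (ram ord).
Local Notation R := (Rinv ord).
Local Notation good_seq := (good_seq ord).

Lemma dfct_mul_le (z : \bar rat) (x y : F) : x != 0 -> y != 0 ->
  (z <= d x -> z <= d y -> z <= d (x * y)%R)%E.
Proof.
move=> xn0 yn0 zx zy; apply: le_trans (dfct_mul VF complete two e_gt0 xn0 yn0).
by rewrite le_min zx.
Qed.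

Lemma dfct_class (x y s : F) : x != 0 -> s != 0 -> y = x * s ^+ 2 -> d y = d x.
Proof. by move=> xn0 sn0 ->; apply: dfct_mul_square. Qed.

Lemma good_bong_good_seq (V : formSpace F) (L : set V) n (a : nat -> F) :
  is_lattice ord L -> good_bong ord L n a -> good_seq n a.
Proof.
move=> HL Ha; split=> [i|i|i]; first exact: good_bong_neq0 Ha.
  exact: good_bong_step HL Ha.
by case: Ha => xs [_ _ _ h] i1 i2; rewrite /Rinv ler_int h.
Qed.

(** At [i = 0] and [i = n] the square class is exact, so the defect is infinite and matches the
    value [+oo] of [alpha_ign]. *)
Lemma approximates_dfct n (a : nat -> F) i x : good_seq n a -> (i <= n)%N ->
  approximates ord n a i x -> (alpha_ign ord n a i <= d (prefix_prod a i * x))%E.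
Proof.
move=> ga ni [xn0]; rewrite /alpha_ign; case: ifP => // _ [c cn0 xE].
have pn0 := prefix_prod_neq0 ga ni.
have [|_ [_ /(_ (prefix_prod a i * c))]] :=
    dfctE VF complete two e_gt0 (a := prefix_prod a i * x).
  by rewrite mulf_neq0.
set y := 1 - _; have -> : y = 0; last by rewrite ordE0 leye_eq => /eqP ->.
by rewrite /y xE; field; rewrite pn0 cn0.
Qed.

(** Up to squares, [X' Y'] is [X Y] times [X X'] and [Y Y'], whose defects are at least the caps
    already present in the bracket. Serves both directions between (ii) and (ii'). *)
Lemma dbr_le m a n b X Y X' Y' i :
  prefix_prod a i != 0 -> prefix_prod b i != 0 ->
  X i != 0 -> Y i != 0 -> X' i != 0 -> Y' i != 0 ->
  (alpha_ign ord m a i <= d (X i * X' i)%R)%E ->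
  (alpha_ign ord n b i <= d (Y i * Y' i)%R)%E ->
  (dbr ord m a n b 1 X Y i i <= dbr ord m a n b 1 X' Y' i i)%E.
Proof.
move=> an0 bn0 xn0 yn0 xn0' yn0' hx hy; rewrite /dbr !mul1r.
set A := alpha_ign _ _ _ _ in hx *; set B := alpha_ign _ _ _ _ in hy *.
rewrite le_min [X in _ && X]ge_min lexx orbT andbT.
have -> : d (X' i * Y' i) = d (X i * Y i * (X i * X' i) * (Y i * Y' i)).
  by apply: dfct_class (X i * Y i)^-1 _ _ _;
    rewrite ?invr_eq0 ?mulf_neq0 //; field; rewrite xn0 yn0.
apply: dfct_mul_le; rewrite ?mulf_neq0 //; last by rewrite !ge_min hy !orbT.
by apply: dfct_mul_le; rewrite ?mulf_neq0 // !ge_min ?lexx ?hx ?orbT.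
Qed.

(** The value [+oo] of [alpha_ign] at 0 and [n] absorbs the boundary clauses [i = 1] and [i = n - 1]
    into the inequalities. *)
Lemma space_approximates_gram n (a : nat -> F) i (V : formSpace F) :
  good_seq n a -> (1 <= i < n)%N -> space_approximates ord n a i V ->
  exists A : 'M[F]_i, [/\ is_gram V A, A \in unitmx, A^T = A,
    (alpha ord n a i <= d (prefix_prod a i * \det A)%R)%E &
    (((2 * e)%:E < alpha_ign ord n a i.-1 + alpha ord n a i)%E ->
       mx_repr A (diag_gram a i.-1)) /\
    (((2 * e)%:E < alpha ord n a i + alpha_ign ord n a i.+1)%E ->
       mx_repr (diag_gram a i.+1) A)].
Proof.
move=> ga hi [Vnd dV Vdet Vl Vu]; have [A VA dA] := is_gram_exists dV.
have Au := is_gram_unit VA Vnd.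
have Du k : (k <= n)%N -> diag_gram a k \in unitmx.
  by move=> kn; rewrite unitmxE det_diag_gram unitfE (prefix_prod_neq0 ga kn).
exists A; split=> //; first exact: is_gram_sym VA.
  have := approximates_dfct ga _ Vdet; rewrite dA /alpha_ign hi; apply; lia.
split=> h.
  apply/(embeds_gram VA (is_gram_diag a i.-1)); first by apply: Du; lia.
  apply: Vl; have [->|i1] := eqVneq i 1%N; [by left | right].
  by move: h; rewrite /alpha_ign ifT //; lia.
apply/(embeds_gram (is_gram_diag a i.+1) VA) => //.
apply: Vu; have [->|i1] := eqVneq i n.-1; [by left | right].
by move: h; rewrite /alpha_ign ifT //; lia.
Qed.

Lemma diag_gram_unit n (a : nat -> F) i : good_seq n a -> (i <= n)%N ->
  diag_gram a i \in unitmx.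
Proof.
by move=> ga ni; rewrite unitmxE det_diag_gram unitfE (prefix_prod_neq0 ga ni).
Qed.

Lemma diag_gram_sym (a : nat -> F) i : (diag_gram a i)^T = diag_gram a i.
Proof. exact: tr_diag_mx. Qed.

Lemma diag_gram_drop (a : nat -> F) i : mx_repr (diag_gram a i.+1) (diag_gram a i).
Proof.
exists (\matrix_(k < i, j < i.+1) (k == j :> nat)%:R).
apply/matrixP => k l; rewrite mxE (bigD1 (widen_ord (leqnSn i) l)) //= big1.
  rewrite mul_mx_diag !mxE eqxx mulr1 addr0 /=.
  by rewrite -val_eqE; case: eqP => [->|_]; rewrite ?mul1r ?mul0r.
by move=> j jl; rewrite !mxE (_ : (l == j :> nat) = false) ?mulr0 //;
  apply: contraNF jl => /eqP ?; apply/eqP/val_inj.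
Qed.

Lemma prefix_prodS (a : nat -> F) i : prefix_prod a i.+1 = prefix_prod a i * a i.+1.
Proof. by rewrite /prefix_prod big_nat_recr. Qed.

(** The index [i] of (iii) is [j + 2], and [B] belongs to the space being embedded. The first
    alternative gives a square over [[a_1, ..., a_{j+1}]], the second a diamond under
    [[a_1, ..., a_{j+3}]]. *)
Lemma embed_approx_target m (a : nat -> F) j (A : 'M[F]_j.+2) (B : 'M[F]_j.+1)
    (x y : \bar rat) :
  good_seq m a -> (j.+2 < m)%N ->
  A \in unitmx -> B \in unitmx -> A^T = A ->
  (alpha ord m a j.+2 <= d (prefix_prod a j.+2 * \det A)%R)%E ->
  (((2 * e)%:E < alpha_ign ord m a j.+1 + alpha ord m a j.+2)%E ->
       mx_repr A (diag_gram a j.+1)) ->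
  (((2 * e)%:E < alpha ord m a j.+2 + alpha_ign ord m a j.+3)%E ->
       mx_repr (diag_gram a j.+3) A) ->
  (0 <= x)%E -> (0 <= y)%E ->
  (x <= alpha_ign ord m a j.+1)%E -> (y <= alpha_ign ord m a j.+3)%E ->
  (x <= d (prefix_prod a j.+1 * \det B)%R)%E ->
  (y <= d (- (prefix_prod a j.+3 * \det B))%R)%E ->
  ((2 * e + R a j.+2 - R a j.+3)%:E < x + y)%E ->
  mx_repr (diag_gram a j.+2) B <-> mx_repr A B.
Proof.
move=> ga jm Au Bu sA dA Al Ar x0 y0 xa ya xd yd xy.
have p1 := @prefix_prod_neq0 _ _ _ _ ga j.+1 (ltnW (ltnW jm)).
have p2 := @prefix_prod_neq0 _ _ _ _ ga j.+2 (ltnW jm).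
have p3 := @prefix_prod_neq0 _ _ _ _ ga j.+3 jm.
have bn0 : \det B != 0 by rewrite -unitfE -unitmxE.
have an0 : \det A != 0 by rewrite -unitfE -unitmxE.
have D1u := diag_gram_unit ga (ltnW (ltnW jm)).
have D2u := diag_gram_unit ga (ltnW jm).
have D3u := diag_gram_unit ga jm.
have dxy : (Order.min x y <= d (- a j.+2 * a j.+3)%R)%E.
  have an2 : a j.+2 != 0 := good_seq_neq0 (i := j.+2) ga (ltnW jm).
  have an3 : a j.+3 != 0 := good_seq_neq0 (i := j.+3) ga jm.
  rewrite -(@dfct_class (- a j.+2 * a j.+3) _ (prefix_prod a j.+1 * \det B) _ _ erefl);
    rewrite ?mulf_neq0 ?oppr_eq0 //.
  have -> : - a j.+2 * a j.+3 * (prefix_prod a j.+1 * \det B) ^+ 2 =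
      (prefix_prod a j.+1 * \det B) * - (prefix_prod a j.+3 * \det B).
    by rewrite !prefix_prodS; ring.
  by apply: dfct_mul_le; rewrite ?oppr_eq0 ?mulf_neq0 // ge_min ?xd ?yd ?orbT.
have isn u v : u != 0 -> v != 0 -> ((2 * e)%:E < d u + d v)%E -> is_norm u v.
  exact: dfct_is_norm.
have [] := alpha_dichotomy (i := j.+2) jm x0 y0 xa ya dxy xy.
  move=> ax; have AD : mx_repr A (diag_gram a j.+1).
    by apply: Al; apply: lt_le_trans ax _; rewrite addeC leeD2r.
  have nrm : is_norm (\det (diag_gram a j.+1) * \det B) (\det (diag_gram a j.+2) * \det A).
    apply: isn; rewrite ?mulf_neq0 ?det_diag_gram //.
    by apply: lt_le_trans ax _; rewrite addeC leeD.
  split=> [UB|AB].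
    exact: (mx_repr_square two D1u Bu D2u Au (diag_gram_sym _ _)
      (diag_gram_sym _ _) sA (diag_gram_drop _ _) AD UB nrm).
  rewrite [\det (diag_gram a j.+2) * _]mulrC in nrm.
  exact: (mx_repr_square two D1u Bu Au D2u (diag_gram_sym _ _) sA
      (diag_gram_sym _ _) AD (diag_gram_drop _ _) AB nrm).
move=> ay; have DA : mx_repr (diag_gram a j.+3) A.
  by apply: Ar; apply: lt_le_trans ay _; rewrite leeD2l.
have nrm : is_norm (- (\det B * \det (diag_gram a j.+3))) (\det (diag_gram a j.+2) * \det A).
  apply: isn; rewrite ?oppr_eq0 ?mulf_neq0 ?det_diag_gram //.
  by apply: lt_le_trans ay _; rewrite addeC leeD // mulrC.
split=> [UB|AB].
  exact: (mx_repr_diamond_bottom two Bu D2u Au D3u (diag_gram_sym _ _) sA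
      (diag_gram_sym _ _) (diag_gram_drop _ _) DA UB nrm).
rewrite [\det (diag_gram a j.+2) * _]mulrC in nrm.
exact: (mx_repr_diamond_bottom two Bu Au D2u D3u sA (diag_gram_sym _ _)
      (diag_gram_sym _ _) DA (diag_gram_drop _ _) AB nrm).
Qed.

(** Now the target [A] is fixed. In the first alternative the diamond runs from [[b_1, ..., b_j]] up
    to [A]; in the second the square has the overspaces [[b_1, ..., b_{j+2}]] and [A]. *)
Lemma embed_approx_source n (b : nat -> F) j (A : 'M[F]_j.+2) (B : 'M[F]_j.+1)
    (x y : \bar rat) :
  good_seq n b -> (j.+1 < n)%N ->
  A \in unitmx -> B \in unitmx -> A^T = A -> B^T = B ->
  (alpha ord n b j.+1 <= d (prefix_prod b j.+1 * \det B)%R)%E ->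
  (((2 * e)%:E < alpha_ign ord n b j + alpha ord n b j.+1)%E ->
       mx_repr B (diag_gram b j)) ->
  (((2 * e)%:E < alpha ord n b j.+1 + alpha_ign ord n b j.+2)%E ->
       mx_repr (diag_gram b j.+2) B) ->
  (0 <= x)%E -> (0 <= y)%E ->
  (x <= alpha_ign ord n b j)%E -> (y <= alpha_ign ord n b j.+2)%E ->
  (x <= d (- (prefix_prod b j * \det A))%R)%E ->
  (y <= d (prefix_prod b j.+2 * \det A)%R)%E ->
  ((2 * e + R b j.+1 - R b j.+2)%:E < x + y)%E ->
  mx_repr A (diag_gram b j.+1) <-> mx_repr A B.
Proof.
move=> gb jn Au Bu sA sB dB Bl Br x0 y0 xa ya xd yd xy.
have p1 := @prefix_prod_neq0 _ _ _ _ gb j (ltnW (ltnW jn)).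
have p2 := @prefix_prod_neq0 _ _ _ _ gb j.+1 (ltnW jn).
have p3 := @prefix_prod_neq0 _ _ _ _ gb j.+2 jn.
have bn0 : \det B != 0 by rewrite -unitfE -unitmxE.
have an0 : \det A != 0 by rewrite -unitfE -unitmxE.
have D1u := diag_gram_unit gb (ltnW (ltnW jn)).
have D2u := diag_gram_unit gb (ltnW jn).
have D3u := diag_gram_unit gb jn.
have dxy : (Order.min x y <= d (- b j.+1 * b j.+2)%R)%E.
  have bn1 : b j.+1 != 0 := good_seq_neq0 (i := j.+1) gb (ltnW jn).
  have bn2 : b j.+2 != 0 := good_seq_neq0 (i := j.+2) gb jn.
  rewrite -(@dfct_class (- b j.+1 * b j.+2) _ (prefix_prod b j * \det A) _ _ erefl);
    rewrite ?mulf_neq0 ?oppr_eq0 //.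
  have -> : - b j.+1 * b j.+2 * (prefix_prod b j * \det A) ^+ 2 =
      - (prefix_prod b j * \det A) * (prefix_prod b j.+2 * \det A).
    by rewrite !prefix_prodS; ring.
  by apply: dfct_mul_le; rewrite ?oppr_eq0 ?mulf_neq0 // ge_min ?xd ?yd ?orbT.
have isn u v : u != 0 -> v != 0 -> ((2 * e)%:E < d u + d v)%E -> is_norm u v.
  exact: dfct_is_norm.
have [] := alpha_dichotomy (i := j.+1) jn x0 y0 xa ya dxy xy.
  move=> bx; have BD : mx_repr B (diag_gram b j).
    by apply: Bl; apply: lt_le_trans bx _; rewrite addeC leeD2r.
  have nrm : is_norm (- (\det (diag_gram b j) * \det A)) (\det (diag_gram b j.+1) * \det B).
    apply: isn; rewrite ?oppr_eq0 ?mulf_neq0 ?det_diag_gram //.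
    by apply: lt_le_trans bx _; rewrite addeC leeD.
  split=> [AD|AB].
    exact: (mx_repr_diamond_top D1u D2u Bu Au (diag_gram_sym _ _) sB sA
      (diag_gram_drop _ _) BD AD nrm).
  rewrite [\det (diag_gram b j.+1) * _]mulrC in nrm.
  exact: (mx_repr_diamond_top D1u Bu D2u Au sB (diag_gram_sym _ _) sA
      BD (diag_gram_drop _ _) AB nrm).
move=> bY; have DB : mx_repr (diag_gram b j.+2) B.
  by apply: Br; apply: lt_le_trans bY _; rewrite leeD2l.
have nrm : is_norm (\det (diag_gram b j.+1) * \det B) (\det (diag_gram b j.+2) * \det A).
  by apply: isn; rewrite ?mulf_neq0 ?det_diag_gram //; apply: lt_le_trans bY _; rewrite leeD.
split=> [AD|AB].
  exact: (mx_repr_square two D2u Bu D3u Au (diag_gram_sym _ _)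
    (diag_gram_sym _ _) sA (diag_gram_drop _ _) AD DB nrm).
rewrite [\det (diag_gram b j.+1) * _]mulrC in nrm.
exact: (mx_repr_square two Bu D2u D3u Au sB
    (diag_gram_sym _ _) sA DB AB (diag_gram_drop _ _) nrm).
Qed.

(** An alpha above [2e] puts the determinants in the same square class and, the preceding alpha
    being nonnegative, also forces the common hyperplane [[a_1, ..., a_i]]. *)
Lemma approx_isometric n (a : nat -> F) i (A : 'M[F]_i.+1) :
  good_seq n a -> (i.+1 < n)%N -> 2 * e < R a i.+2 - R a i.+1 ->
  A \in unitmx -> A^T = A ->
  (alpha ord n a i.+1 <= d (prefix_prod a i.+1 * \det A)%R)%E ->
  (((2 * e)%:E < alpha_ign ord n a i + alpha ord n a i.+1)%E ->
       mx_repr A (diag_gram a i)) ->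
  mx_repr A (diag_gram a i.+1) /\ mx_repr (diag_gram a i.+1) A.
Proof.
move=> ga ni big Au sA dA Al.
have al : ((2 * e)%:E < alpha ord n a i.+1)%E.
  by apply: (alpha_gt_2e ga VF complete two e_gt0).
have p2 := @prefix_prod_neq0 _ _ _ _ ga i.+1 (ltnW ni).
have an0 : \det A != 0 by rewrite -unitfE -unitmxE.
have D1u := diag_gram_unit ga (ltnW (ltnW ni)).
have D2u := diag_gram_unit ga (ltnW ni).
have AD : mx_repr A (diag_gram a i).
  apply: Al; apply: lt_le_trans al _; rewrite -[leLHS]add0e leeD2r //.
  rewrite /alpha_ign; case: ifP => [/andP[i1 _]|_]; last exact: leey.
  by apply: (alpha_ge0 ga VF complete two e_gt0); lia.
have [s sn0 sE] := dfct_square VF complete two e_gt0 (mulf_neq0 p2 an0) (lt_le_trans al dA).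
suff DA : mx_repr (diag_gram a i.+1) A by split=> //; apply: mx_repr_sym DA.
apply: (mx_repr_same_det (T := diag_gram a i) (s := s / prefix_prod a i.+1)) => //.
- exact: diag_gram_sym.
- exact: diag_gram_drop.
by rewrite det_diag_gram expr_div_n -sE; field.
Qed.

End Approximations.

(** * Transfer of conditions (iii) and (iv) to approximations *)

Section ApproximatedConditions.
Variables (F : fieldType) (ord : F -> int).
Hypothesis VF : is_valuation ord.
Hypothesis complete : forall u, cauchy_seq ord u -> exists l, converges_to ord u l.
Hypothesis two : (2 : F) != 0.
Hypothesis e_gt0 : 0 < ord 2.

Local Notation d := (dfct ord).
Local Notation e := (ram ord).
Local Notation R := (Rinv ord).

Lemma lt_adde_shift (c r : rat) (u v x y : \bar rat) :
  (c%:E < u + v -> u <= x -> v <= r%:E + y -> (c - r)%:E < x + y)%E.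
Proof.
move=> cuv ux vy; have {cuv ux vy} : (c%:E < x + (r%:E + y))%E.
  by apply: lt_le_trans cuv _; apply: leeD.
case: x => [x||] //; case: y => [y||] //; rewrite ?addey ?addye ?ltry //.
by rewrite -!EFinD !lte_fin; lra.
Qed.

Variables (m n : nat) (a b : nat -> F).
Hypotheses (ga : good_seq ord m a) (gb : good_seq ord n b).

Local Notation dab := (dab ord m a n b).
Local Notation Ainv := (Ainv ord m a n b).
Local Notation PA := (prefix_prod a).
Local Notation PB := (prefix_prod b).

Lemma alpha_ign_ge0 k (c : nat -> F) i : good_seq ord k c -> (0 <= alpha_ign ord k c i)%E.
Proof.
move=> gc; rewrite /alpha_ign; case: ifP => [hi|_]; last exact: leey.
by apply: (alpha_ge0 gc VF complete two e_gt0).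
Qed.

Lemma dab_ge0 (eps : F) i j : eps != 0 -> (i <= m)%N -> (j <= n)%N -> (0 <= dab eps i j)%E.
Proof.
move=> en0 im jn; rewrite /dab /dbr !le_min !alpha_ign_ge0 // !andbT.
apply: (dfct_ge0 VF complete two e_gt0).
by rewrite !mulf_neq0 ?(prefix_prod_neq0 ga) ?(prefix_prod_neq0 gb).
Qed.

Lemma dab_le (eps : F) i j : [/\ (dab eps i j <= d (eps * PA i * PB j)%R)%E,
  (dab eps i j <= alpha_ign ord m a i)%E & (dab eps i j <= alpha_ign ord n b j)%E].
Proof. by rewrite /dab /dbr !ge_min !lexx !orbT. Qed.

Lemma Ainv_le i :
  (Ainv i <= (R a i.+1 - R b i)%:E + dab (-1) i.+1 i.-1)%E.
Proof. by rewrite /Defs.Ainv !ge_min lexx !orbT. Qed.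

(** [S_i] cancels against the second term of [A_i]; for [i = n + 1] the symbol [S_{n+1} + A_{n+1}]
    has this cancellation built in, so both readings give the same bound. *)
Lemma Asum_gt_target j : cond_dbr ord m a n b PA PB ->
  (j.+2 <= m.-1)%N -> (j.+1 <= n)%N -> Asum_gt ord m a n b j.+2 ->
  ((2 * e + R a j.+2 - R a j.+3)%:E < dab 1 j.+1 j.+1 + dab (-1) j.+3 j.+1)%E.
Proof.
move=> hD jm jn; have {}hD : (Ainv j.+1 <= dab 1 j.+1 j.+1)%E.
  by apply: hD; rewrite leq_min jn (ltnW jm).
rewrite /Asum_gt; case: (ltnP j.+1 n) => jn' h.
  have := lt_adde_shift h hD (Ainv_le j.+2).
  by congr (_%:E < _)%E; lra.
have en : n = j.+1 by apply/eqP; rewrite eqn_leq jn' jn.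
have SA : (SAinv ord m a n b <= (R a j.+3)%:E + dab (-1) j.+3 j.+1)%E.
  by rewrite -en /SAinv ge_min lexx.
have {}h : ((2 * e + R a j.+2)%:E < Ainv j.+1 + SAinv ord m a n b)%E.
  by move: h; rewrite -en.
have := lt_adde_shift h hD SA.
by congr (_%:E < _)%E; lra.
Qed.

(** Here (ii) bounds [A_i] rather than [A_{i-1}], and [R_i] cancels against the second term of
    [A_{i-1}]. *)
Lemma Asum_gt_source j : cond_dbr ord m a n b PA PB ->
  (j.+2 <= m.-1)%N -> (j.+2 <= n)%N -> Asum_gt ord m a n b j.+2 ->
  ((2 * e + R b j.+1 - R b j.+2)%:E < dab (-1) j.+2 j + dab 1 j.+2 j.+2)%E.
Proof.
move=> hD jm jn; have {}hD : (Ainv j.+2 <= dab 1 j.+2 j.+2)%E.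
  by apply: hD; rewrite leq_min jn jm.
rewrite /Asum_gt jn addeC => h.
rewrite addeC; have := lt_adde_shift h hD (Ainv_le j.+1).
by congr (_%:E < _)%E; lra.
Qed.

Variables V W : nat -> formSpace F.
Hypothesis HV : forall i, (1 <= i < m)%N -> space_approximates ord m a i (V i).
Hypothesis HW : forall i, (1 <= i < n)%N -> space_approximates ord n b i (W i).
Hypothesis HWn : is_gram (W n) (diag_gram b n).

Lemma embeds_diag_space i j : (j <= n)%N ->
  embeds (diag_space b j) (diag_space a i) <-> mx_repr (diag_gram a i) (diag_gram b j).
Proof.
move=> jn; apply: embeds_gram; [exact: is_gram_diag | exact: is_gram_diag |].
exact: diag_gram_unit gb jn.
Qed.

Lemma embeds_approx1 j : cond_dbr ord m a n b PA PB ->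
  (j.+2 <= m.-1)%N -> (j.+1 <= n)%N -> Asum_gt ord m a n b j.+2 ->
  embeds (diag_space b j.+1) (diag_space a j.+2) <-> embeds (W j.+1) (V j.+2).
Proof.
move=> hD jm jn hA; have jm' : (j.+2 < m)%N by move: jm; case: (m).
have [A [VA Au sA dA [Al Ar]]] :=
  space_approximates_gram VF complete two e_gt0 (i := j.+2) ga jm'
    (HV (i := j.+2) jm').
have an0 : \det A != 0 by rewrite -unitfE -unitmxE.
have B0u := diag_gram_unit gb jn.
have pa i : (i <= m)%N -> PA i != 0 := @prefix_prod_neq0 _ _ _ _ ga i.
have pb i : (i <= n)%N -> PB i != 0 := @prefix_prod_neq0 _ _ _ _ gb i.
have target : mx_repr (diag_gram a j.+2) (diag_gram b j.+1) <-> mx_repr A (diag_gram b j.+1).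
  have [x1 x2 _] := dab_le 1 j.+1 j.+1.
  have [y1 y2 _] := dab_le (-1) j.+3 j.+1.
  apply: (embed_approx_target VF complete two e_gt0 ga jm' Au B0u sA dA Al Ar
    _ _ x2 y2 _ _ (Asum_gt_target hD jm jn hA)).
  - by apply: dab_ge0 => //; rewrite ?oner_eq0 // (ltnW (ltnW jm')).
  - by apply: dab_ge0; rewrite ?oppr_eq0 ?oner_eq0.
  - by rewrite det_diag_gram; rewrite mul1r in x1.
  - by rewrite det_diag_gram; rewrite mulN1r mulNr in y1.
rewrite embeds_diag_space // target.
(* For [j + 1 = n] the space [W n] is already isometric to [[b_1, ..., b_n]]; below [n] a second
   exchange follows. *)
move: jn B0u {target}; rewrite leq_eqVlt => /predU1P[jn|jn] B0u.
  have WB : is_gram (W j.+1) (diag_gram b j.+1) by rewrite jn.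
  by symmetry; apply: embeds_gram.
have [B [WB Bu sB dB [Bl Br]]] :=
  space_approximates_gram VF complete two e_gt0 (i := j.+1) gb jn
    (HW (i := j.+1) jn).
rewrite (embeds_gram VA WB Bu).
have [x1 x2 x3] := dab_le (-1) j.+2 j.
have [y1 y2 y3] := dab_le 1 j.+2 j.+2.
(* This cap lets [\det A] replace [a_{1,j+2}] in the two defects below. *)
have alA (z : \bar rat) : (z <= alpha_ign ord m a j.+2 -> z <= d (PA j.+2 * \det A)%R)%E.
  by rewrite /alpha_ign /= jm' => h; apply: le_trans dA.
have p1 := pa j.+2 (ltnW jm'); have p2 := pb j (ltnW (ltnW jn)); have p3 := pb j.+2 jn.
apply: (embed_approx_source VF complete two e_gt0 gb jn Au Bu sA sB dB Bl Br
  _ _ x3 y3 _ _ (Asum_gt_source hD jm jn hA)).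
- by apply: dab_ge0; rewrite ?oppr_eq0 ?oner_eq0 // ltnW // ltnW.
- by apply: dab_ge0; rewrite ?oner_eq0 // ltnW.
- rewrite -(@dfct_class _ _ VF complete two e_gt0 (- (PB j * \det A)) _
    (PA j.+2) _ _ erefl) ?oppr_eq0 ?mulf_neq0 //.
  have -> : - (PB j * \det A) * PA j.+2 ^+ 2 =
      (-1 * PA j.+2 * PB j) * (PA j.+2 * \det A) by ring.
  by apply: (dfct_mul_le VF complete two e_gt0); rewrite ?mulf_neq0 ?oppr_eq0 ?oner_eq0 ?alA.
- rewrite -(@dfct_class _ _ VF complete two e_gt0 (PB j.+2 * \det A) _
    (PA j.+2) _ _ erefl) ?mulf_neq0 //.
  have -> : PB j.+2 * \det A * PA j.+2 ^+ 2 =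
      (1 * PA j.+2 * PB j.+2) * (PA j.+2 * \det A) by ring.
  by apply: (dfct_mul_le VF complete two e_gt0); rewrite ?mulf_neq0 ?oner_eq0 ?alA.
Qed.

Lemma embeds_approx2 j : (j.+3 < m)%N -> (j.+1 <= n)%N ->
  ((j.+2 <= n)%N -> R a j.+4 <= R b j.+2) ->
  R b j.+1 + 2 * e < R a j.+4 -> R a j.+3 + 2 * e <= R b j.+1 + 2 * e ->
  embeds (diag_space b j.+1) (diag_space a j.+3) <-> embeds (W j.+1) (V j.+3).
Proof.
move=> jm jn h1 h2 h3.
have [A [VA Au sA dA [Al _]]] :=
  space_approximates_gram VF complete two e_gt0 (i := j.+3) ga jm
    (HV (i := j.+3) jm).
have B0u := diag_gram_unit gb jn.
(* With [i = j + 2], the gap [R_{i+2} - R_{i+1} > 2e] comes from [R_{i+1} <= S_{i-1}] and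
   [S_{i-1} + 2e < R_{i+2}]. *)
have [AD DA] : mx_repr A (diag_gram a j.+3) /\ mx_repr (diag_gram a j.+3) A.
  by apply: (approx_isometric VF complete two e_gt0 ga jm) => //; lra.
have [B [WB Bu BD DB]] : exists B : 'M[F]_j.+1, [/\ is_gram (W j.+1) B, B \in unitmx,
    mx_repr B (diag_gram b j.+1) & mx_repr (diag_gram b j.+1) B].
  (* Below [n] the gap [S_i - S_{i-1} > 2e] comes from [S_i >= R_{i+2}]; at [n], where that
     inequality is ignored, the space is known exactly. *)
  have [jn'|jn'] := eqVneq j.+1 n.
    by exists (diag_gram b j.+1); split=> //; [rewrite jn' | exact: mx_repr_refl..].
  have {}jn' : (j.+1 < n)%N by rewrite ltn_neqAle jn' jn.
  have [B [WB Bu sB dB [Bl _]]] :=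
    space_approximates_gram VF complete two e_gt0 (i := j.+1) gb jn'
      (HW (i := j.+1) jn').
  exists B; have [] // := approx_isometric VF complete two e_gt0 gb jn' _ Bu sB dB Bl.
  by move: (h1 jn'); lra.
rewrite embeds_diag_space // (embeds_gram VA WB Bu).
split=> h; first exact: mx_repr_trans AD (mx_repr_trans h DB).
exact: mx_repr_trans DA (mx_repr_trans h BD).
Qed.

End ApproximatedConditions.

Theorem lemma3p10
  (Q2 : fieldType) (v2 : Q2 -> int) (HQ2 : is_Q2 v2)
  (F : fieldExtType Q2) (ord : F -> int) (Hord : is_normalized_ord v2 ord)
  (m n : nat) (Hmn : (n <= m)%N)
  (VM VN : formSpace F) (HVM : nondeg VM) (HVN : nondeg VN)
  (M : set VM) (N : set VN)
  (HM : is_lattice ord M) (HN : is_lattice ord N)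
  (a b : nat -> F) (Ha : good_bong ord M m a) (Hb : good_bong ord N n b)
  (X Y : nat -> F) (V W : nat -> formSpace F)
  (HX : forall i, (i <= m)%N -> approximates ord m a i (X i))
  (HY : forall i, (i <= n)%N -> approximates ord n b i (Y i))
  (HV : forall i, (1 <= i < m)%N -> space_approximates ord m a i (V i))
  (HW : forall i, (1 <= i < n)%N -> space_approximates ord n b i (W i))
  (HWn : isometric_to_subspace (W n) (fspan N))
  (Hi : cond_ord ord m a n b) :
  (cond_dbr ord m a n b (prefix_prod a) (prefix_prod b) /\
   cond_embed1 ord m a n b (diag_space a) (diag_space b) /\
   cond_embed2 ord m a n b (diag_space a) (diag_space b))
  <->
  (cond_dbr ord m a n b X Y /\
   cond_embed1 ord m a n b V W /\
   cond_embed2 ord m a n b V W).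
Proof.
have VF := ord_valuation Hord; have e_gt0 := ord2_gt0 Hord.
have complete := finite_extension_complete HQ2 Hord.
have two : (2 : F) != 0.
  rewrite -(rmorph_nat (in_alg F)) fmorph_eq0.
  by apply/negP => h; have := Q2_char HQ2 2%N; rewrite !inE h.
have ga := good_bong_good_seq VF complete two e_gt0 HM Ha.
have gb := good_bong_good_seq VF complete two e_gt0 HN Hb.
have WN := is_gram_bong Hb HWn.
have nz i : (1 <= i <= minn m.-1 n)%N -> [/\ prefix_prod a i != 0, prefix_prod b i != 0,
    X i != 0, Y i != 0 & (alpha_ign ord m a i <= dfct ord (prefix_prod a i * X i))%E /\
    (alpha_ign ord n b i <= dfct ord (prefix_prod b i * Y i))%E].
  move=> /andP[_]; rewrite leq_min => /andP[im jn].
  have {}im : (i <= m)%N by apply: leq_trans im (leq_pred m).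
  have [X0 _] := HX i im; have [Y0 _] := HY i jn.
  by split; rewrite ?(prefix_prod_neq0 ga) ?(prefix_prod_neq0 gb) //; split;
    apply: (approximates_dfct VF complete two e_gt0); auto.
have dbrE : cond_dbr ord m a n b (prefix_prod a) (prefix_prod b) <->
    cond_dbr ord m a n b X Y.
  split=> h i hi; apply: le_trans (h i hi) _; have [pa pb X0 Y0 [dX dY]] := nz i hi;
    by apply: (dbr_le VF complete two e_gt0); rewrite // mulrC.
have emb1 : cond_dbr ord m a n b (prefix_prod a) (prefix_prod b) ->
    cond_embed1 ord m a n b (diag_space a) (diag_space b) <->
    cond_embed1 ord m a n b V W.
  move=> hD; split=> h [|[|j]] // hj hR hA; have := h j.+2 hj hR hA;
    move: hj; rewrite leq_min => /andP[_ /andP[jm jn]];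
    by have [] := embeds_approx1 VF complete two e_gt0 ga gb HV HW WN hD jm jn hA.
have emb2 : cond_embed2 ord m a n b (diag_space a) (diag_space b) <->
    cond_embed2 ord m a n b V W.
  split=> h [|[|j]] // hj h1 h2 h3; have := h j.+2 hj h1 h2 h3;
    move: hj; rewrite leq_min ltn_subRL => /andP[_ /andP[jm jn]];
    by have [] := embeds_approx2 VF complete two e_gt0 ga gb HV HW WN jm jn h1 h2 h3.
split=> -[hD [h1 h2]].
  by split; [apply/dbrE | split; [apply/emb1 | apply/emb2]].
(* (ii) is recovered first, because the comparison of (iii) with (iii') relies on it. *)
have hD' : cond_dbr ord m a n b (prefix_prod a) (prefix_prod b) by apply/dbrE.
by split=> //; split; [apply/emb1 | apply/emb2].
Qed.
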